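(* Let $(w_1,w_2)$ be a pair of cyclic sequences of $O$ and $U$ of even length. If the OU numbers satisfy $\Phi(w_1)\neq\Phi(w_2)$, then any oriented two-component link diagram $D$ on $S^2$ with $\hat f(D)=(w_1,w_2)$ has a self-crossing.
   Context: A diagram of a two-component link is written $D=K_1\cup K_2$ with its knot components ordered. A self-crossing of $D$ is a crossing of a component with itself; a non-self crossing is a crossing between distinct components. The non-self OU sequence $\hat f(K_i)$ is the cyclic sequence (sequence up to cyclic rotation, possibly empty) of letters $O$ and $U$ obtained by traversing $K_i$ along its orientation and recording, at each non-self crossing met, $O$ if $K_i$ passes over and $U$ if $K_i$ passes under (self-crossings are ignored). Put $\hat f(D)=(\hat f(K_1),\hat f(K_2))$. OU number: for a non-cyclic sequence $S$ of $O$ and $U$, let $N^O_o$ (resp. $N^O_e$) be the number of $O$s in odd (resp. even) positions of $S$, and $N^U_o$ (resp. $N^U_e$) the number of $U$s in odd (resp. even) positions; put $\Phi(S)=\frac12(N^O_e+N^U_o-N^O_o-N^U_e)$. For a cyclic sequence $w$ of even length, $\Phi(w)=|\Phi(S)|$, where $S$ is the non-cyclic sequence obtained from $w$ by choosing any initial letter (this is independent of the choice). *)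

(* Defs.v *)
From Stdlib Require Import Reals List Sorted Bool Arith Lia Lra.
From Coquelicot Require Import Coquelicot.
Import ListNotations.
Open Scope R_scope.

(** * OU sequences *)

Inductive letter : Set := Over | Under.

Definition letter_eqb (x y : letter) : bool :=
  match x, y with
  | Over, Over | Under, Under => true
  | _, _ => false
  end.

Inductive parity : Set := Odd | Even.

(* Positions are numbered from 1. *)
Definition has_parity (p : parity) (k : nat) : bool :=
  match p with Odd => Nat.odd k | Even => Nat.even k end.

Definition occ_from (a : nat) (x : letter) (p : parity) (s : list letter) : nat :=
  length (filter (fun ky => has_parity p (fst ky) && letter_eqb x (snd ky))
                 (combine (seq a (length s)) s)).

Definition occ : letter -> parity -> list letter -> nat := occ_from 1.

Definition Phi_seq (s : list letter) : R :=
  / 2 * (INR (occ Over Even s) + INR (occ Under Odd s)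
         - INR (occ Over Odd s) - INR (occ Under Even s)).

(* A cyclic sequence is given by a list representing it, that is, a list
   considered up to [rotation]. *)
Definition rotation (s s' : list letter) : Prop :=
  exists u v, s = u ++ v /\ s' = v ++ u.

(* For even length this depends only on the cyclic sequence: see
   [OU_number_rotation]. *)
Definition OU_number (w : list letter) : R := Rabs (Phi_seq w).

Lemma occ_from_shift a x s :
  occ_from (1 + a) x Odd s = occ_from a x Even s /\
  occ_from (1 + a) x Even s = occ_from a x Odd s.
Proof.
revert a; induction s as [|y s IH]; intro a; [now split|].
unfold occ_from in *; cbn [length seq combine filter fst snd has_parity].
destruct (IH (1 + a)%nat) as [H1 H2].
change (S a) with (1 + a)%nat in *; change (S (1 + a)) with (1 + (1 + a))%nat.
replace (Nat.odd (1 + a)) with (Nat.even a) by (rewrite Nat.odd_succ; easy).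
replace (Nat.even (1 + a)) with (Nat.odd a) by (rewrite Nat.even_succ; easy).
destruct (Nat.even a), (Nat.odd a), (letter_eqb x y);
  cbn [andb length]; rewrite ?H1, ?H2; auto.
Qed.

Lemma occ_from_app a x p u v :
  occ_from a x p (u ++ v) =
  (occ_from a x p u + occ_from (length u + a) x p v)%nat.
Proof.
revert a; induction u as [|y u IH]; intro a; [easy|].
specialize (IH (S a)); unfold occ_from in *.
cbn [app length seq combine filter fst snd].
replace (S (length u) + a)%nat with (length u + S a)%nat by lia.
destruct (_ && _); cbn [length]; rewrite IH; lia.
Qed.

Lemma occ_from_parity a x p s :
  occ_from (a + 1) x p s =
  occ x (if Nat.even a then p else match p with Odd => Even | Even => Odd end) s.
Proof.
revert p; induction a as [|a IH]; intro p; [easy|].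
replace (S a + 1)%nat with (1 + (a + 1))%nat by lia.
rewrite Nat.even_succ, <- Nat.negb_even.
destruct (occ_from_shift (a + 1) x s) as [H1 H2].
destruct p; rewrite ?H1, ?H2, IH; destruct (Nat.even a); easy.
Qed.

Lemma Phi_seq_app u v :
  Phi_seq (u ++ v) =
  Phi_seq u + (if Nat.even (length u) then Phi_seq v else - Phi_seq v).
Proof.
unfold Phi_seq, occ at 1 2 3 4.
rewrite !occ_from_app, !occ_from_parity, !plus_INR.
fold occ; destruct (Nat.even (length u)); lra.
Qed.

Lemma OU_number_rotation s s' :
  Nat.Even (length s) -> rotation s s' -> OU_number s = OU_number s'.
Proof.
intros He (u & v & -> & ->); unfold OU_number.
apply Nat.even_spec in He; rewrite length_app, Nat.even_add in He.
rewrite !Phi_seq_app.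
destruct (Nat.even (length u)), (Nat.even (length v)); try easy.
- now rewrite Rplus_comm.
- now rewrite <- Rabs_Ropp; f_equal; lra.
Qed.

(** * Two-component link diagrams on the unit sphere *)

Record vec3 : Set := Vec3 { cx : R; cy : R; cz : R }.

Definition on_S2 (p : vec3) : Prop := cx p ^ 2 + cy p ^ 2 + cz p ^ 2 = 1.

Definition cross (p q : vec3) : vec3 :=
  Vec3 (cy p * cz q - cz p * cy q)
       (cz p * cx q - cx p * cz q)
       (cx p * cy q - cy p * cx q).

Definition smooth (g : R -> vec3) : Prop :=
  forall n t, ex_derive_n (fun s => cx (g s)) n t /\
              ex_derive_n (fun s => cy (g s)) n t /\
              ex_derive_n (fun s => cz (g s)) n t.

Definition velocity (g : R -> vec3) (t : R) : vec3 :=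
  Vec3 (Derive (fun s => cx (g s)) t)
       (Derive (fun s => cy (g s)) t)
       (Derive (fun s => cz (g s)) t).

Inductive component : Set := K1 | K2.

(* The circle is R/Z.  A map out of two disjoint circles is a family of
   1-periodic maps, and a point of the two circles is a pair (i, t) with t in
   the fundamental domain [0, 1). *)
Definition circle_point (a : component * R) : Prop := 0 <= snd a < 1.

(* [a] and [b] are the two preimages of a double point. *)
Definition crossing (g : component -> R -> vec3) (a b : component * R) : Prop :=
  circle_point a /\ circle_point b /\ a <> b /\
  g (fst a) (snd a) = g (fst b) (snd b).

(* A generic immersion of two ordered, oriented circles, with over/under
   information at each crossing.  The orientations are those of increasing
   parameter.  [pass] says how the diagram passes at a preimage of a crossing;
   its values elsewhere are irrelevant. *)
Record diagram := Diagram {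
  curve : component -> R -> vec3;
  pass : component -> R -> letter;
  curve_periodic : forall i t, curve i (t + 1) = curve i t;
  curve_on_S2 : forall i t, on_S2 (curve i t);
  curve_smooth : forall i, smooth (curve i);
  curve_regular : forall i t, velocity (curve i) t <> Vec3 0 0 0;
  crossings_finite :
    exists l, forall a b, crossing curve a b -> In a l;
  crossings_double :
    forall a b c, crossing curve a b -> crossing curve a c -> b = c;
  crossings_transverse :
    forall a b, crossing curve a b ->
    cross (velocity (curve (fst a)) (snd a))
          (velocity (curve (fst b)) (snd b)) <> Vec3 0 0 0;
  crossings_over_under :
    forall a b, crossing curve a b ->
    pass (fst a) (snd a) <> pass (fst b) (snd b)
}.

Definition has_self_crossing (D : diagram) : Prop :=
  exists a b, crossing (curve D) a b /\ fst a = fst b.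

Definition at_nonself_crossing (D : diagram) (i : component) (t : R) : Prop :=
  exists b, crossing (curve D) (i, t) b /\ fst b <> i.

(* [w] represents the non-self OU sequence of component [i]: the increasing
   list of parameters is the traversal starting from parameter 0. *)
Definition is_nonself_OU (D : diagram) (i : component) (w : list letter) : Prop :=
  exists ts, StronglySorted Rlt ts /\
             (forall t, In t ts <-> at_nonself_crossing D i t) /\
             rotation (map (pass D i) ts) w.

Definition is_nonself_OU_pair (D : diagram) (w : list letter * list letter) : Prop :=
  is_nonself_OU D K1 (fst w) /\ is_nonself_OU D K2 (snd w).

(* Main.v *)
Require Import Defs.
From Stdlib Require Import Reals List Arith.
From Stdlib Require Import ZArith Ranalysis5 Lia Lra Nsatz.
From Stdlib Require Import Sorted Permutation Classical.
From Coquelicot Require Import Coquelicot.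
Import ListNotations.
Open Scope R_scope.

(** Suppose that there is no self-crossing, so that both components are simple
    closed curves.  Give each crossing the sign of the determinant of its point
    and the velocities of the two components.  Along either component, these
    signs alternate ([pairing_alternates]).  Hence the position parities used by
    the OU number may be replaced by the signs: the OU number of a component is
    half the absolute value of the sum, over all crossings, of the letter read
    there (1 or -1) times the sign of the crossing ([OU_number_eq_sum]).  When the
    components are exchanged, every letter changes, since one strand is over and
    the other under, and so does every sign; the terms of the two sums agree one by
    one ([contribution_swap]), and the OU numbers are equal.

    Alternation is a form of the Jordan curve theorem: an arc that meets a simple
    closed curve at its ends only comes back to the side from which it left.
    After a stereographic projection ([crossing_sign_alternates]) the statement is
    about plane curves ([same_side_at_both_ends]), and is proved by following
    angles.  Let [W] be the total turning, over one period, of the direction from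
    a point of the open arc to a point moving along the closed curve.  It is a
    multiple of 2 pi varying continuously, hence constant along the arc.
    Likewise, let [h] be the total turning of the direction from a point of the
    closed curve to a point moving once around the curve, from the forward
    tangent to the backward one.  It is an odd multiple of pi, and constant along the
    curve ([chord_turning]); simplicity of the curve is used here, to make these
    chords nonzero.  As the point of view moves from the curve onto the arc, the
    turning jumps from [h] to [h + pi] or [h - pi], according to the side
    ([turning_jump]).  The two ends of the arc share [h] and [W], so the side is
    the same.

    Continuous choices of angles come from [angle_on_rect], which lifts a
    nonvanishing map on a rectangle to a continuous argument. *)

(** * Angles in the plane *)

Definition dot (u v : R * R) : R := fst u * fst v + snd u * snd v.
Definition det (u v : R * R) : R := fst u * snd v - snd u * fst v.
Definition sub (u v : R * R) : R * R := (fst u - fst v, snd u - snd v).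
Definition len (u : R * R) : R := sqrt (dot u u).

(** The angle [th] is one of the arguments of the nonzero vector [v]. *)
Definition points_at (th : R) (v : R * R) : Prop :=
  exists r, 0 < r /\ v = (r * cos th, r * sin th).

(** The signed angle in (-pi, pi) from [u] to [v].  The half-angle formula, unlike
    the arctangent of the ratio [det u v / dot u v], is continuous for all [v]
    outside the closed half-line opposite to [u]. *)
Definition turn (u v : R * R) : R :=
  2 * atan (det u v / (len u * len v + dot u v)).

Lemma len_pos v : v <> (0, 0) -> 0 < len v.
Proof.
intros Hv; apply sqrt_lt_R0; unfold dot.
destruct v as [x y]; cbn.
destruct (Req_dec x 0) as [->|Hx]; [|nra].
destruct (Req_dec y 0) as [->|Hy]; [now elim Hv|nra].
Qed.

Lemma len_sqr v : len v * len v = dot v v.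
Proof. apply sqrt_sqrt; unfold dot; nra. Qed.

Lemma len_nonneg v : 0 <= len v.
Proof. apply sqrt_pos. Qed.

Lemma lagrange_identity u v :
  (len u * len v) * (len u * len v) = dot u v * dot u v + det u v * det u v.
Proof.
replace ((len u * len v) * (len u * len v))
  with ((len u * len u) * (len v * len v)) by ring.
rewrite !len_sqr; unfold dot, det; ring.
Qed.

(** For nonzero [u] and [v], the hypothesis says that they are not opposite; it is the
    form in which this is checked and used below. *)
Lemma turn_den_pos u v :
  0 < dot u v \/ det u v <> 0 -> 0 < len u * len v + dot u v.
Proof.
intros H.
assert (H0 : 0 <= len u * len v) by (apply Rmult_le_pos; apply len_nonneg).
destruct H as [H|H]; [lra|].
pose proof (lagrange_identity u v) as L.
assert (0 < det u v * det u v) by nra.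
nra.
Qed.

Lemma turn_range u v : - PI < turn u v < PI.
Proof.
unfold turn; destruct (atan_bound (det u v / (len u * len v + dot u v))); lra.
Qed.

Lemma atan_pos x : 0 < x -> 0 < atan x.
Proof. intros H; rewrite <- atan_0; now apply atan_increasing. Qed.

Lemma turn_pos u v : 0 < det u v -> 0 < turn u v.
Proof.
intros H; unfold turn.
apply Rmult_lt_0_compat; [lra|]; apply atan_pos.
apply Rdiv_lt_0_compat; [easy|apply turn_den_pos; right; lra].
Qed.

Lemma turn_neg u v : det u v < 0 -> turn u v < 0.
Proof.
intros H; unfold turn.
assert (H1 := turn_den_pos u v (or_intror (Rlt_not_eq _ _ H))).
replace (det u v / (len u * len v + dot u v))
  with (- (- det u v / (len u * len v + dot u v))) by (field; lra).
rewrite atan_opp.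
assert (0 < atan (- det u v / (len u * len v + dot u v))); [|lra].
apply atan_pos, Rdiv_lt_0_compat; lra.
Qed.

(** Adding [turn u v] to an argument of [u] gives an argument of [v]: with [D] the
    product of the lengths, [d] the dot product and [e] the determinant, the half
    angle has cosine and sine proportional to [D + d] and [e], and [D * D = d * d +
    e * e] turns the duplication formulas into cosine [d / D] and sine [e / D]. *)
Lemma points_at_turn th u v :
  0 < dot u v \/ det u v <> 0 -> points_at th u -> points_at (th + turn u v) v.
Proof.
intros H (r & Hr & Eu).
assert (Hden := turn_den_pos u v H).
assert (L := lagrange_identity u v).
assert (HD : 0 <= len u * len v) by (apply Rmult_le_pos; apply len_nonneg).
unfold turn.
set (D := len u * len v) in *; set (d := dot u v) in *; set (e := det u v) in *.
set (t := atan (e / (D + d))).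
assert (HDp : 0 < D).
{ destruct HD as [HD|HD]; [easy|].
  assert (d * d <= 0) by nra; assert (d = 0) by nra; lra. }
assert (Ct : 0 < cos t).
{ unfold t; destruct (atan_bound (e / (D + d))); apply cos_gt_0; lra. }
assert (Ht : sin t = e / (D + d) * cos t).
{ assert (Ht := tan_atan (e / (D + d))); fold t in Ht; unfold tan in Ht.
  rewrite <- Ht; field; lra. }
set (k := cos t / (D + d)).
assert (Ck : cos t = k * (D + d)) by (unfold k; field; lra).
assert (Sk : sin t = k * e) by (rewrite Ht; unfold k; field; lra).
assert (One : cos t * cos t + sin t * sin t = 1).
{ pose proof (sin2_cos2 t) as E; unfold Rsqr in E; lra. }
assert (Kp : 0 < k) by (apply Rdiv_lt_0_compat; lra).
set (m := 2 * k * k * (D + d)).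
assert (Mp : 0 < m) by (unfold m; apply Rmult_lt_0_compat; [nra|lra]).
assert (MD : m * D = 1).
{ rewrite <- One, Ck, Sk; unfold m.
  transitivity (k * k * (D * D + 2 * (D * d) + D * D)); [ring|rewrite L at 2; ring]. }
assert (C2 : cos (2 * t) = m * d).
{ rewrite cos_2a, Ck, Sk; unfold m.
  transitivity (k * k * (D * D + 2 * (D * d) + d * d - e * e)); [ring|rewrite L; ring]. }
assert (S2 : sin (2 * t) = m * e).
{ rewrite sin_2a, Ck, Sk; unfold m; ring. }
exists (/ (m * r)); split; [apply Rinv_0_lt_compat; nra|].
rewrite cos_plus, sin_plus, C2, S2.
pose proof (sin2_cos2 th) as E; unfold Rsqr in E.
destruct v as [v1 v2]; subst u; unfold d, e, dot, det; cbn.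
f_equal.
- transitivity (v1 * (sin th * sin th + cos th * cos th)); [rewrite E; ring|field; lra].
- transitivity (v2 * (sin th * sin th + cos th * cos th)); [rewrite E; ring|field; lra].
Qed.

Lemma points_at_scale th v k :
  0 < k -> points_at th v -> points_at th (k * fst v, k * snd v).
Proof.
intros Hk (r & Hr & ->); exists (k * r); split; [nra|]; cbn; f_equal; ring.
Qed.

Lemma points_at_opp th v : points_at th v -> points_at (th + PI) (- fst v, - snd v).
Proof.
intros (r & Hr & ->); exists r; split; [easy|].
rewrite neg_cos, neg_sin; cbn; f_equal; ring.
Qed.

Lemma points_at_exists v : v <> (0, 0) -> exists th, points_at th v.
Proof.
intros Hv.
assert (P0 : forall x, 0 < x -> points_at 0 (x, 0)).
{ intros x Hx; exists x; split; [easy|]; rewrite cos_0, sin_0; f_equal; ring. }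
destruct v as [x y].
destruct (Req_dec y 0) as [->|Hy].
- destruct (Rtotal_order x 0) as [H|[->|H]].
  + exists (0 + PI); replace (x, 0) with (- fst (- x, 0), - snd (-x, 0)).
    * apply points_at_opp, P0; lra.
    * cbn; f_equal; ring.
  + now elim Hv.
  + exists 0; auto.
- exists (0 + turn (1, 0) (x, y)); apply points_at_turn; [|apply P0; lra].
  right; unfold det; cbn; lra.
Qed.

Lemma points_at_unique th th' v :
  points_at th v -> points_at th' v -> exists k : Z, th - th' = 2 * PI * IZR k.
Proof.
intros (r & Hr & E) (r' & Hr' & E').
rewrite E in E'; injection E' as E1 E2.
pose proof (sin2_cos2 th) as Q; pose proof (sin2_cos2 th') as Q'; unfold Rsqr in *.
assert (r = r').
{ assert (r * r = r' * r'); [|nra].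
  transitivity (r * r * (sin th * sin th + cos th * cos th)); [rewrite Q; ring|].
  transitivity (r' * r' * (sin th' * sin th' + cos th' * cos th')); [|rewrite Q'; ring].
  transitivity ((r * sin th) * (r * sin th) + (r * cos th) * (r * cos th)); [ring|].
  rewrite E1, E2; ring. }
subst r'.
apply Rmult_eq_reg_l in E1; [|lra]; apply Rmult_eq_reg_l in E2; [|lra].
assert (Hc : cos (th - th') = 1) by (rewrite cos_minus, E1, E2; lra).
set (x := (th - th') / 2).
assert (Hs : sin x = 0).
{ replace (th - th') with (2 * x) in Hc by (unfold x; field).
  rewrite cos_2a_sin in Hc; nra. }
destruct (sin_eq_0_0 _ Hs) as [k Hk]; exists k; unfold x in Hk; lra.
Qed.

(** A continuous choice of argument for [f] at the points of [P].  Continuity is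
    that of [th] as a function on the whole space, so that restricting [P] or
    reading [th] along a line costs nothing. *)
Definition angle_on {U : UniformSpace} (P : U -> Prop) (f : U -> R * R) (th : U -> R) :=
  forall x, P x -> continuous th x /\ points_at (th x) (f x).

Definition plane_continuous {U : UniformSpace} (f : U -> R * R) (x : U) : Prop :=
  continuous (fun z => fst (f z)) x /\ continuous (fun z => snd (f z)) x.

Section Continuity.
Context {U : UniformSpace}.
Implicit Types (f g : U -> R) (x : U).
Lemma continuous_Rplus f g x :
  continuous f x -> continuous g x -> continuous (fun z => f z + g z) x.
Proof. exact (continuous_plus (V := R_NormedModule) f g x). Qed.
Lemma continuous_Rminus f g x :
  continuous f x -> continuous g x -> continuous (fun z => f z - g z) x.
Proof. exact (continuous_minus (V := R_NormedModule) f g x). Qed.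
Lemma continuous_Rmult f g x :
  continuous f x -> continuous g x -> continuous (fun z => f z * g z) x.
Proof. exact (continuous_mult (K := R_AbsRing) f g x). Qed.
Lemma continuous_Rdiv f g x :
  continuous f x -> continuous g x -> g x <> 0 -> continuous (fun z => f z / g z) x.
Proof.
intros Hf Hg H; apply continuous_Rmult; [easy|].
exact (continuous_comp g Rinv x Hg (continuous_Rinv _ H)).
Qed.
End Continuity.

Section Continuity2.
Context {U : UniformSpace}.
Implicit Types (f g : U -> R * R) (x : U).
Lemma continuous_dot f g x :
  plane_continuous f x -> plane_continuous g x -> continuous (fun z => dot (f z) (g z)) x.
Proof.
intros [] []; apply continuous_Rplus; now apply continuous_Rmult.
Qed.
Lemma continuous_det f g x :
  plane_continuous f x -> plane_continuous g x -> continuous (fun z => det (f z) (g z)) x.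
Proof.
intros [] []; apply continuous_Rminus; now apply continuous_Rmult.
Qed.
Lemma continuous_len f x : plane_continuous f x -> continuous (fun z => len (f z)) x.
Proof.
intros H.
exact (continuous_comp (fun z => dot (f z) (f z)) sqrt x
   (continuous_dot f f x H H) (continuous_sqrt _)).
Qed.
Lemma continuous_turn f g x :
  plane_continuous f x -> plane_continuous g x ->
  0 < dot (f x) (g x) \/ det (f x) (g x) <> 0 ->
  continuous (fun z => turn (f z) (g z)) x.
Proof.
intros Hf Hg H; apply turn_den_pos in H.
apply continuous_Rmult; [apply continuous_const|].
apply (continuous_comp
  (fun z => det (f z) (g z) / (len (f z) * len (g z) + dot (f z) (g z))) atan).
2: apply continuous_atan.
apply continuous_Rdiv; [now apply continuous_det| |lra].
apply continuous_Rplus; [|now apply continuous_dot].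
apply continuous_Rmult; now apply continuous_len.
Qed.
Lemma plane_continuous_sub f g x :
  plane_continuous f x -> plane_continuous g x ->
  plane_continuous (fun z => sub (f z) (g z)) x.
Proof. intros [] []; split; cbn; now apply continuous_Rminus. Qed.
Lemma plane_continuous_const (v : R * R) x : plane_continuous (fun _ => v) x.
Proof. split; apply continuous_const. Qed.
Lemma plane_continuous_comp {V : UniformSpace} (h : V -> U) f (y : V) :
  continuous h y -> plane_continuous f (h y) -> plane_continuous (fun z => f (h z)) y.
Proof.
intros Hh [H1 H2]; split.
- exact (continuous_comp h (fun z => fst (f z)) y Hh H1).
- exact (continuous_comp h (fun z => snd (f z)) y Hh H2).
Qed.
End Continuity2.

Lemma continuous_pair {U : UniformSpace} (f g : U -> R) (x : U) :
  continuous f x -> continuous g x -> continuous (fun z => (f z, g z)) x.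
Proof.
intros Hf Hg; apply (continuous_comp_2 f g (fun a b => (a, b))); auto.
apply continuous_ext with (fun p => p); [now intros []|apply continuous_id].
Qed.

Definition rect (a b c d : R) (z : R * R) : Prop :=
  a <= fst z <= b /\ c <= snd z <= d.

(** The point of the segment from [p] to [z] at ratio [l]. *)
Definition toward (p : R * R) (l : R) (z : R * R) : R * R :=
  (fst p + l * (fst z - fst p), snd p + l * (snd z - snd p)).

Lemma toward_1 p z : toward p 1 z = z.
Proof. destruct z; unfold toward; cbn [fst snd]; f_equal; ring. Qed.

Lemma continuous_toward p l z : continuous (toward p l) z.
Proof.
unfold toward; destruct z as [x y].
apply continuous_pair; apply continuous_Rplus;
  try apply continuous_const; apply continuous_Rmult;
  try apply continuous_const; apply continuous_Rminus; try apply continuous_const.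
- apply continuous_fst.
- apply continuous_snd.
Qed.

Lemma rect_toward a b c d l z :
  0 <= l <= 1 -> rect a b c d z -> rect a b c d (toward (a, c) l z).
Proof. destruct z as [x y]; unfold rect; cbn; intros H [H1 H2]; split; nra. Qed.

(** Unit vectors whose coordinates differ by less than 1/2 are at distance less than
    the square root of 2, hence make an acute angle. *)
Lemma unit_close (u v : R * R) :
  u <> (0, 0) -> v <> (0, 0) ->
  Rabs (fst u / len u - fst v / len v) < / 2 ->
  Rabs (snd u / len u - snd v / len v) < / 2 ->
  0 < dot u v.
Proof.
intros Hu Hv H1 H2.
apply len_pos in Hu as Lu; apply len_pos in Hv as Lv.
apply Rabs_def2 in H1; apply Rabs_def2 in H2.
assert (E : dot u v =
  len u * len v * (fst u / len u * (fst v / len v) + snd u / len u * (snd v / len v))).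
{ unfold dot; field; lra. }
assert (Eu : fst u / len u * (fst u / len u) + snd u / len u * (snd u / len u) = 1).
{ transitivity (dot u u / (len u * len u)); [unfold dot; field; lra|].
  rewrite len_sqr; field; rewrite <- len_sqr; nra. }
assert (Ev : fst v / len v * (fst v / len v) + snd v / len v * (snd v / len v) = 1).
{ transitivity (dot v v / (len v * len v)); [unfold dot; field; lra|].
  rewrite len_sqr; field; rewrite <- len_sqr; nra. }
rewrite E; repeat apply Rmult_lt_0_compat; try easy.
set (p := fst u / len u) in *; set (q := snd u / len u) in *.
set (p' := fst v / len v) in *; set (q' := snd v / len v) in *.
assert ((p - p') * (p - p') < / 2 * / 2) by nra.
assert ((q - q') * (q - q') < / 2 * / 2) by nra.
nra.
Qed.

Lemma uniform_on_rect (f : R * R -> R) a b c d eps :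
  0 < eps -> (forall z, rect a b c d z -> continuous f z) ->
  exists del, 0 < del /\ forall z z', rect a b c d z -> rect a b c d z' ->
  Rabs (fst z' - fst z) < del -> Rabs (snd z' - snd z) < del ->
  Rabs (f z' - f z) < eps.
Proof.
intros He Hf.
destruct (uniform_continuity_2d (fun x y => f (x, y)) a b c d) with (eps := mkposreal _ He)
  as [del Hdel].
- intros x y Hx Hy; apply continuity_2d_pt_filterlim.
  apply filterlim_ext with f; [now intros []|].
  apply (Hf (x, y)); now split.
- exists del; split; [apply cond_pos|].
  intros [x y] [u v] [H1 H2] [H3 H4]; cbn in *; now apply Hdel.
Qed.

Lemma continuous_unit (F : R * R -> R * R) z :
  plane_continuous F z -> F z <> (0, 0) ->
  plane_continuous (fun z => (fst (F z) / len (F z), snd (F z) / len (F z))) z.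
Proof.
intros H H0; apply len_pos in H0; pose proof H as [H1 H2].
split; cbn; apply continuous_Rdiv; try apply continuous_len; auto; lra.
Qed.

(** A nonvanishing continuous map on a rectangle has a continuous argument.  The
    rectangle is shrunk to its corner along segments; by uniform continuity of the
    direction, these can be cut into [N] steps, the same [N] for all end points,
    each changing the direction by less than a right angle.  The sum of the [turn]s
    over the steps is then continuous in the end point. *)
Lemma angle_on_rect (F : R * R -> R * R) a b c d :
  a <= b -> c <= d ->
  (forall z, rect a b c d z -> plane_continuous F z /\ F z <> (0, 0)) ->
  exists th, angle_on (rect a b c d) F th.
Proof.
intros Hab Hcd HF.
assert (Hp : rect a b c d (a, c)) by (unfold rect; cbn; lra).
destruct (uniform_on_rect (fun z => fst (F z) / len (F z)) a b c d (/ 2))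
  as (d1 & P1 & U1); [lra| |].
{ intros z Hz; destruct (HF z Hz) as [H1 H2]; apply (continuous_unit F z H1 H2). }
destruct (uniform_on_rect (fun z => snd (F z) / len (F z)) a b c d (/ 2))
  as (d2 & P2 & U2); [lra| |].
{ intros z Hz; destruct (HF z Hz) as [H1 H2]; apply (continuous_unit F z H1 H2). }
set (del := Rmin d1 d2).
assert (Pd : 0 < del) by now apply Rmin_pos.
set (L := (b - a) + (d - c) + 1).
assert (HL : 0 < L) by (unfold L; lra).
destruct (nfloor_ex (L / del)) as [n Hn].
{ apply Rlt_le, Rdiv_lt_0_compat; auto. }
set (N := S n).
assert (HN : 0 < INR N) by (apply lt_0_INR; unfold N; lia).
assert (HNd : L / INR N < del).
{ apply Rmult_lt_reg_r with (INR N); [easy|].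
  replace (L / INR N * INR N) with L by (field; lra).
  replace L with (L / del * del) by (field; lra).
  rewrite (Rmult_comm del); apply Rmult_lt_compat_r; [easy|].
  unfold N; rewrite S_INR; lra. }
assert (Hl : forall k, (k <= N)%nat -> 0 <= INR k / INR N <= 1).
{ intros k Hk; apply le_INR in Hk; pose proof (pos_INR k); split.
  - apply Rmult_le_pos; [easy|apply Rlt_le, Rinv_0_lt_compat; easy].
  - apply Rmult_le_reg_r with (INR N); [easy|].
    replace (INR k / INR N * INR N) with (INR k) by (field; lra); lra. }
assert (Step : forall k z, (S k <= N)%nat -> rect a b c d z ->
  0 < dot (F (toward (a, c) (INR k / INR N) z)) (F (toward (a, c) (INR (S k) / INR N) z))).
{ intros k z Hk Hz.
  assert (R1 := rect_toward _ _ _ _ _ _ (Hl k ltac:(lia)) Hz).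
  assert (R2 := rect_toward _ _ _ _ _ _ (Hl (S k) Hk) Hz).
  assert (Hs : INR k / INR N - INR (S k) / INR N = - / INR N).
  { rewrite S_INR; field; lra. }
  assert (Iv : 0 < / INR N) by now apply Rinv_0_lt_compat.
  assert (A : forall w, 0 <= w < L -> Rabs (INR k / INR N * w - INR (S k) / INR N * w) < del).
  { intros w Hw; rewrite <- Rmult_minus_distr_r, Hs, Rabs_mult, Rabs_Ropp, !Rabs_pos_eq by lra.
    apply Rle_lt_trans with (L / INR N); [unfold Rdiv; nra|easy]. }
  assert (A1 : Rabs (INR k / INR N * (fst z - a) - INR (S k) / INR N * (fst z - a)) < del).
  { apply A; destruct Hz; unfold L; lra. }
  assert (A2 : Rabs (INR k / INR N * (snd z - c) - INR (S k) / INR N * (snd z - c)) < del).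
  { apply A; destruct Hz; unfold L; lra. }
  assert (M1 := Rmin_l d1 d2); assert (M2 := Rmin_r d1 d2); fold del in M1, M2.
  apply unit_close; [apply HF, R1|apply HF, R2| |].
  - apply U1; auto; cbn [toward fst snd];
    match goal with |- Rabs (?p + ?x - (?p + ?y)) < _ => replace (p + x - (p + y))
      with (x - y) by ring end; lra.
  - apply U2; auto; cbn [toward fst snd];
    match goal with |- Rabs (?p + ?x - (?p + ?y)) < _ => replace (p + x - (p + y))
      with (x - y) by ring end; lra. }
assert (Ind : forall k, (k <= N)%nat -> exists th,
  angle_on (rect a b c d) (fun z => F (toward (a, c) (INR k / INR N) z)) th).
{ induction k as [|k IH]; intros Hk.
  - destruct (points_at_exists (F (a, c))) as [th Hth]; [now apply HF|].
    exists (fun _ => th); intros z Hz; split; [apply continuous_const|].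
    replace (toward (a, c) (INR 0 / INR N) z) with (a, c); [easy|].
    unfold toward; cbn; f_equal; unfold Rdiv; ring.
  - destruct IH as [th Hth]; [lia|].
    exists (fun z => th z + turn (F (toward (a, c) (INR k / INR N) z))
                                 (F (toward (a, c) (INR (S k) / INR N) z))).
    intros z Hz; destruct (Hth z Hz) as [C1 C2].
    assert (R1 := rect_toward _ _ _ _ _ _ (Hl k ltac:(lia)) Hz).
    assert (R2 := rect_toward _ _ _ _ _ _ (Hl (S k) Hk) Hz).
    specialize (Step k z Hk Hz).
    split.
    + apply continuous_Rplus; [easy|].
      apply (continuous_turn (fun z => F (toward (a, c) (INR k / INR N) z))
                (fun z => F (toward (a, c) (INR (S k) / INR N) z))).
      * apply (plane_continuous_comp (toward (a, c) (INR k / INR N)) F);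
          [apply continuous_toward|apply HF, R1].
      * apply (plane_continuous_comp (toward (a, c) (INR (S k) / INR N)) F);
          [apply continuous_toward|apply HF, R2].
      * now left.
    + apply points_at_turn; [now left|easy]. }
destruct (Ind N (le_n _)) as [th Hth]; exists th; intros z Hz.
destruct (Hth z Hz) as [C1 C2]; split; [easy|].
replace (toward (a, c) (INR N / INR N) z) with z in C2; [easy|].
replace (INR N / INR N) with 1 by (field; lra).
symmetry; apply toward_1.
Qed.

(** A continuous function with values in a translate of the multiples of 2 pi is
    constant, by the intermediate value theorem halfway to the next value. *)
Lemma constant_of_discrete (g : R -> R) a b al :
  a <= b -> (forall s, a <= s <= b -> continuous g s) ->
  (forall s, a <= s <= b -> exists k : Z, g s = al + 2 * PI * IZR k) ->
  g a = g b.
Proof.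
assert (Main : forall g a b al, a <= b -> (forall s, a <= s <= b -> continuous g s) ->
  (forall s, a <= s <= b -> exists k : Z, g s = al + 2 * PI * IZR k) -> ~ g a < g b).
{ clear; intros g a b al Hab Hc Hk Hlt.
  assert (PP := PI_RGT_0).
  assert (Hab' : a < b) by (destruct Hab as [|<-]; [easy|lra]).
  destruct (Hk a) as [ka Ea]; [lra|]; destruct (Hk b) as [kb Eb]; [lra|].
  assert (Hz : (ka < kb)%Z) by (apply lt_IZR; nra).
  assert (Hz' : IZR ka + 1 <= IZR kb) by (rewrite <- plus_IZR; apply IZR_le; lia).
  destruct (IVT_interv (fun s => g s - (g a + PI)) a b) as [z [Hz1 Hz2]]; try lra.
  - intros s Hs; apply continuity_pt_filterlim.
    refine (continuous_Rminus g (fun _ => g a + PI) s _ _);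
      [auto|apply continuous_const].
  - nra.
  - destruct (Hk z Hz1) as [k Ek].
    assert (E : IZR (2 * ka + 1) = IZR (2 * k)).
    { rewrite plus_IZR, !mult_IZR; nra. }
    apply eq_IZR in E; lia. }
intros Hab Hc Hk; destruct (Rtotal_order (g a) (g b)) as [H|[H|H]]; auto.
- now elim (Main g a b al).
- exfalso; apply (Main (fun s => - g s) a b (- al)); [easy| | |lra].
  + intros s Hs; apply (continuous_opp (V := R_NormedModule) g); auto.
  + intros s Hs; destruct (Hk s Hs) as [k E]; exists (- k)%Z; rewrite opp_IZR; lra.
Qed.

Definition segment (a b s : R) : Prop := a <= s <= b.

Lemma angle_change_unique (f : R -> R * R) th th' a b :
  a <= b -> angle_on (segment a b) f th -> angle_on (segment a b) f th' ->
  th b - th a = th' b - th' a.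
Proof.
intros Hab H H'.
assert (th a - th' a = th b - th' b); [|lra].
apply (constant_of_discrete (fun s => th s - th' s)) with (al := 0); auto.
- intros s Hs; apply continuous_Rminus; [apply H|apply H']; easy.
- intros s Hs; destruct (points_at_unique (th s) (th' s) (f s)) as [k E].
  + apply H; easy.
  + apply H'; easy.
  + exists k; rewrite E; ring.
Qed.

(** * Chords of a closed curve *)

(** The difference quotient [(f (s + t) - f s) / t], extended by the derivative to the
    line [t = 0]. *)
Definition quotient (f df : R -> R) (z : R * R) : R :=
  if Req_EM_T (snd z) 0 then df (fst z)
  else (f (fst z + snd z) - f (fst z)) / snd z.

Lemma quotient_mean_value f df z :
  (forall s, is_derive f s (df s)) ->
  exists xi, quotient f df z = df xi /\ Rabs (xi - fst z) <= Rabs (snd z).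
Proof.
intros Hf; destruct z as [s t]; unfold quotient; cbn [fst snd].
destruct (Req_EM_T t 0) as [->|Ht].
- exists s; split; [easy|]; rewrite Rminus_diag, Rabs_R0; apply Rle_refl.
- destruct (MVT_cor4 f df s (Rabs t)) with (b := s + t) as (xi & E & B).
  + intros; apply Hf.
  + right; f_equal; ring.
  + replace (s + t - s) with t in * by ring.
    exists xi; split; [rewrite E; now field|easy].
Qed.

(** On the line [t = 0] this is where continuity of the derivative enters, through
    the mean value theorem. *)
Lemma continuous_quotient f df z :
  (forall s, is_derive f s (df s)) -> (forall s, continuous df s) ->
  continuous (quotient f df) z.
Proof.
intros Hf Hd; destruct z as [s t].
assert (Cf : forall x, continuous f x).
{ intros x; apply (ex_derive_continuous (K := R_AbsRing) (V := R_NormedModule)).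
  exists (df x); apply Hf. }
destruct (Req_dec t 0) as [->|Ht].
- apply filterlim_locally; intros eps.
  destruct (proj1 (filterlim_locally _ _) (Hd s) eps) as [del Hdel].
  assert (P : 0 < del / 2) by (destruct del; cbn; lra).
  exists (mkposreal _ P); intros [s' t'] [B1 B2]; cbn in B1, B2.
  destruct (quotient_mean_value f df (s', t') Hf) as (xi & -> & B); cbn [fst snd] in B.
  assert (E0 : quotient f df (s, 0) = df s).
  { unfold quotient; cbn [fst snd]; destruct (Req_EM_T 0 0); [easy|lra]. }
  change (Rabs (df xi - quotient f df (s, 0)) < eps); rewrite E0; apply Hdel.
  change (Rabs (s' - s) < del / 2) in B1; change (Rabs (t' - 0) < del / 2) in B2.
  change (Rabs (xi - s) < del); rewrite Rminus_0_r in B2.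
  replace (xi - s) with ((xi - s') + (s' - s)) by ring.
  eapply Rle_lt_trans; [apply Rabs_triang|lra].
- apply continuous_ext_loc with (fun z => (f (fst z + snd z) - f (fst z)) / snd z).
  + assert (P : 0 < Rabs t) by now apply Rabs_pos_lt.
    exists (mkposreal _ P); intros [s' t'] [_ B2]; cbn in B2.
    change (Rabs (t' - t) < Rabs t) in B2.
    unfold quotient; cbn [fst snd]; destruct (Req_EM_T t' 0) as [->|]; [|easy].
    rewrite Rminus_0_l, Rabs_Ropp in B2; lra.
  + apply continuous_Rdiv; [apply continuous_Rminus| |easy].
    * apply (continuous_comp (fun z : R * R => fst z + snd z) f); [|apply Cf].
      apply continuous_Rplus; [apply continuous_fst|apply continuous_snd].
    * apply (continuous_comp (fst : R * R -> R) f); [apply continuous_fst|apply Cf].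
    * apply continuous_snd.
Qed.

Definition secant (c dc : R -> R * R) (z : R * R) : R * R :=
  (quotient (fun s => fst (c s)) (fun s => fst (dc s)) z,
   quotient (fun s => snd (c s)) (fun s => snd (dc s)) z).

Record simple_loop (c dc : R -> R * R) : Prop := {
  loop_derive_fst : forall s, is_derive (fun s => fst (c s)) s (fst (dc s));
  loop_derive_snd : forall s, is_derive (fun s => snd (c s)) s (snd (dc s));
  loop_continuous_derive : forall s, plane_continuous dc s;
  loop_regular : forall s, dc s <> (0, 0);
  loop_periodic : forall s, c (s + 1) = c s;
  loop_simple : forall s t, 0 < t < 1 -> c (s + t) <> c s }.

(** For [0 < t < 1] this is the vector from [c s] to [c (s + t)] divided by
    [t * (1 - t)].  Normalised in this way, the direction of the chord extends
    continuously to [t = 0], by the velocity at [s], and to [t = 1], by the opposite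
    of the velocity.  Writing it as a difference of two secants makes the
    continuity evident on the whole plane. *)
Definition chord (c dc : R -> R * R) (z : R * R) : R * R :=
  sub (secant c dc z) (secant c dc (fst z, snd z - 1)).

Lemma sub_eq_0 u v : sub u v = (0, 0) -> u = v.
Proof. destruct u, v; intros [= H1 H2]; cbn in *; f_equal; lra. Qed.

Lemma scale_eq_0 k (v : R * R) : k <> 0 -> (k * fst v, k * snd v) = (0, 0) -> v = (0, 0).
Proof.
intros Hk E; injection E as E1 E2; destruct v; cbn in *.
apply Rmult_integral in E1; apply Rmult_integral in E2; f_equal; tauto.
Qed.

Lemma secant_0 c dc s : secant c dc (s, 0) = dc s.
Proof.
unfold secant, quotient; cbn; destruct (Req_EM_T 0 0); [|lra].
now destruct (dc s).
Qed.

Lemma secant_neq c dc s t : t <> 0 ->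
  secant c dc (s, t) = (/ t * fst (sub (c (s + t)) (c s)), / t * snd (sub (c (s + t)) (c s))).
Proof.
intros H; unfold secant, quotient, sub; cbn [fst snd].
destruct (Req_EM_T t 0); [easy|]; f_equal; unfold Rdiv; ring.
Qed.

Section Loop.
Variables c dc : R -> R * R.
Hypothesis L : simple_loop c dc.

Lemma loop_continuous s : plane_continuous c s.
Proof.
split; apply (ex_derive_continuous (K := R_AbsRing) (V := R_NormedModule)).
- eexists; apply (loop_derive_fst _ _ L).
- eexists; apply (loop_derive_snd _ _ L).
Qed.

Lemma continuous_chord z : plane_continuous (chord c dc) z.
Proof.
destruct L as [L1 L2 L3 L4 L5 L6].
assert (C : forall z, plane_continuous (secant c dc) z).
{ intros w; split; cbn; apply continuous_quotient; auto; apply L3. }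
apply plane_continuous_sub; [apply C|].
apply (plane_continuous_comp (fun z : R * R => (fst z, snd z - 1)) (secant c dc)); [|apply C].
destruct z; apply continuous_pair; [apply continuous_fst|].
apply continuous_Rminus; [apply continuous_snd|apply continuous_const].
Qed.

Lemma chord_0 s : chord c dc (s, 0) = dc s.
Proof.
unfold chord; cbn [fst snd]; rewrite secant_0, secant_neq by lra.
pose proof (loop_periodic _ _ L (s + (0 - 1))) as E.
replace (s + (0 - 1) + 1) with s in E by ring; rewrite <- E.
destruct (dc s); unfold sub; cbn; f_equal; ring.
Qed.

Lemma chord_1 s : chord c dc (s, 1) = (- fst (dc s), - snd (dc s)).
Proof.
unfold chord; cbn [fst snd]; replace (1 - 1) with 0 by ring.
rewrite secant_0, secant_neq, (loop_periodic _ _ L) by lra.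
destruct (dc s); unfold sub; cbn; f_equal; ring.
Qed.

Lemma chord_inside s t : 0 < t < 1 ->
  chord c dc (s, t) = (/ (t * (1 - t)) * fst (sub (c (s + t)) (c s)),
                       / (t * (1 - t)) * snd (sub (c (s + t)) (c s))).
Proof.
intros Ht; unfold chord; cbn [fst snd]; rewrite !secant_neq by lra.
pose proof (loop_periodic _ _ L (s + (t - 1))) as E.
replace (s + (t - 1) + 1) with (s + t) in E by ring; rewrite <- E.
unfold sub; cbn [fst snd]; f_equal; field; lra.
Qed.

Lemma chord_neq_0 s t : 0 <= t <= 1 -> chord c dc (s, t) <> (0, 0).
Proof.
intros Ht; pose proof (loop_regular _ _ L s) as Hd.
destruct (Req_dec t 0) as [->|]; [now rewrite chord_0|].
destruct (Req_dec t 1) as [->|].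
- rewrite chord_1; intros [= E1 E2]; apply Hd; destruct (dc s); cbn in *; f_equal; lra.
- rewrite chord_inside by lra; intros E.
  apply (loop_simple _ _ L s t); [lra|]; apply sub_eq_0.
  revert E; apply scale_eq_0, Rinv_neq_0_compat; nra.
Qed.

(** As [t] goes from 0 to 1, the direction of the chord from [c s] turns from the
    velocity to its opposite, so by an odd multiple of pi, and this multiple cannot
    depend on [s]. *)
Lemma chord_turning :
  exists h, (exists k : Z, h = PI + 2 * PI * IZR k) /\
  forall s, 0 <= s <= 1 -> exists th,
    angle_on (segment 0 1) (fun t => chord c dc (s, t)) th /\ th 1 - th 0 = h.
Proof.
destruct (angle_on_rect (chord c dc) 0 1 0 1) as [th Hth]; try lra.
{ intros [s t] [H1 H2]; split; [apply continuous_chord|now apply chord_neq_0]. }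
assert (Hpi : forall s, 0 <= s <= 1 -> exists k : Z, th (s, 1) - th (s, 0) = PI + 2 * PI * IZR k).
{ intros s Hs; destruct (Hth (s, 1)) as [_ P1]; [split; cbn; lra|].
  destruct (Hth (s, 0)) as [_ P0]; [split; cbn; lra|].
  rewrite chord_0 in P0; rewrite chord_1 in P1; apply points_at_opp in P0.
  destruct (points_at_unique _ _ _ P1 P0) as [k E]; exists k; lra. }
assert (Cs : forall t z : R, rect 0 1 0 1 (z, t) -> continuous (fun s => th (s, t)) z).
{ intros t z Hz; apply (continuous_comp (fun s : R => (s, t)) th).
  - apply continuous_pair; [apply continuous_id|apply continuous_const].
  - now apply Hth. }
exists (th (0, 1) - th (0, 0)); split; [apply Hpi; lra|].
intros s Hs; exists (fun t => th (s, t)); split.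
- intros t Ht; split; [|apply (Hth (s, t)); now split].
  apply (continuous_comp (fun t : R => (s, t)) th).
  + apply continuous_pair; [apply continuous_const|apply continuous_id].
  + apply Hth; now split.
- symmetry; apply (constant_of_discrete (fun s => th (s, 1) - th (s, 0))) with (al := PI); [lra| |].
  + intros x Hx; apply continuous_Rminus; apply Cs; split; cbn; lra.
  + intros x Hx; apply Hpi; lra.
Qed.

End Loop.

(** A path crossing the line spanned by [u] once, on the side of [u], makes less than a
    full turn, counterclockwise or clockwise according to the side from which it
    comes: the argument based at [u] is continuous along it, because the path avoids
    the half-line opposite to [u]. *)
Lemma window_turning (f : R -> R * R) m eta u ka :
  0 < eta -> (forall s, segment (m - eta) (m + eta) s -> plane_continuous f s) ->
  (forall s, segment (m - eta) (m + eta) s -> s <> m -> 0 < ka * ((s - m) * det u (f s))) ->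
  0 < dot u (f m) -> u <> (0, 0) ->
  exists th, angle_on (segment (m - eta) (m + eta)) f th /\
    0 < ka * (th (m + eta) - th (m - eta)) /\
    -(2 * PI) < th (m + eta) - th (m - eta) < 2 * PI.
Proof.
intros He Hf Hd H0 Hu.
assert (Cond : forall s, segment (m - eta) (m + eta) s -> 0 < dot u (f s) \/ det u (f s) <> 0).
{ intros s Hs; destruct (Req_dec s m) as [->|Hn]; [now left|right].
  specialize (Hd s Hs Hn); intros E; rewrite E in Hd; lra. }
destruct (points_at_exists u Hu) as [a Ha].
exists (fun s => a + turn u (f s)); split; [|split].
- intros s Hs; split.
  + apply continuous_Rplus; [apply continuous_const|].
    apply (continuous_turn (fun _ => u) f); auto; apply plane_continuous_const.
  + apply points_at_turn; auto.
- assert (H1 := Hd (m + eta) ltac:(unfold segment; lra) ltac:(lra)).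
  assert (H2 := Hd (m - eta) ltac:(unfold segment; lra) ltac:(lra)).
  replace (m + eta - m) with eta in H1 by ring.
  replace (m - eta - m) with (- eta) in H2 by ring.
  assert (P1 : 0 < ka * det u (f (m + eta))) by nra.
  assert (P2 : ka * det u (f (m - eta)) < 0) by nra.
  destruct (Rtotal_order ka 0) as [Hk|[->|Hk]]; [|lra|].
  + assert (turn u (f (m + eta)) < 0) by (apply turn_neg; nra).
    assert (0 < turn u (f (m - eta))) by (apply turn_pos; nra).
    nra.
  + assert (0 < turn u (f (m + eta))) by (apply turn_pos; nra).
    assert (turn u (f (m - eta)) < 0) by (apply turn_neg; nra).
    nra.
- pose proof (turn_range u (f (m + eta))); pose proof (turn_range u (f (m - eta))); lra.
Qed.

(** The path [b], starting at [c s0], leaves the curve [c] to the side prescribed by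
    the sign of [ka]: seen from [c s0], the points [b d] with [d > 0] lie to the right
    of the forward branch of [c] and to the left of the backward branch if
    [ka > 0], and conversely if [ka < 0].  No derivative occurs, so that the
    same notion serves at both ends of an arc, the second one traversed backwards. *)
Definition departs (ka : R) (c : R -> R * R) (s0 : R) (b : R -> R * R) : Prop :=
  exists eta, 0 < eta /\ forall d s, 0 < d <= eta -> s <> s0 ->
  s0 - eta <= s <= s0 + eta ->
  0 < ka * ((s - s0) * det (sub (b d) (c s0)) (sub (c s) (c s0))).

Lemma angle_on_sub {U : UniformSpace} (P Q : U -> Prop) f th :
  (forall x, P x -> Q x) -> angle_on Q f th -> angle_on P f th.
Proof. intros H H' x Hx; auto. Qed.

Lemma continuous_near (f : R -> R) x eps :
  0 < eps -> continuous f x ->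
  exists del, 0 < del /\ forall y, Rabs (y - x) < del -> Rabs (f y - f x) < eps.
Proof.
intros He Hf; destruct (proj1 (filterlim_locally _ _) Hf (mkposreal _ He)) as [d Hd].
exists d; split; [apply cond_pos|]; intros y Hy; exact (Hd y Hy).
Qed.

Lemma positive_below_four x y z t :
  0 < x -> 0 < y -> 0 < z -> 0 < t ->
  exists e, 0 < e /\ e < x /\ e < y /\ e < z /\ e < t.
Proof.
intros Hx Hy Hz Ht.
exists (Rmin (Rmin x y) (Rmin z t) / 2).
assert (P : 0 < Rmin (Rmin x y) (Rmin z t)) by (repeat apply Rmin_pos; assumption).
pose proof (Rmin_l (Rmin x y) (Rmin z t)); pose proof (Rmin_r (Rmin x y) (Rmin z t)).
pose proof (Rmin_l x y); pose proof (Rmin_r x y).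
pose proof (Rmin_l z t); pose proof (Rmin_r z t).
lra.
Qed.

(** Let [h] be the turning of the chord from [c s0], and [W] the turning of [c] seen
    from [b d] over one period, for a small [d > 0].  Then [W - h] is pi or - pi
    according to the side of [c] on which [b] departs.  Far from [s0] the curve
    looks the same from [b d] and from [c s0].  On a short window around [s0] the
    chord hardly turns on either side of [s0], while the curve seen from [b d] turns by
    an amount [J] of known sign, less than 2 pi in absolute value.  So [W - h] is
    within pi of [J]; being an odd multiple of pi, it is determined by the sign. *)
Lemma turning_jump c dc s0 b dm ka th :
  simple_loop c dc -> 0 < dm ->
  (forall d, 0 <= d <= dm -> plane_continuous b d) -> b 0 = c s0 ->
  (forall d s, 0 < d <= dm -> c s <> b d) ->
  departs ka c s0 b ->
  angle_on (segment 0 1) (fun t => chord c dc (s0, t)) th ->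
  (exists k : Z, th 1 - th 0 = PI + 2 * PI * IZR k) ->
  exists eta d0, 0 < eta < / 2 /\ 0 < d0 <= dm /\
  forall d ps, 0 < d <= d0 ->
    angle_on (segment (s0 - eta) (s0 - eta + 1)) (fun s => sub (c s) (b d)) ps ->
    0 < ka * ((th 1 - th 0) - (ps (s0 - eta + 1) - ps (s0 - eta))).
Proof.
intros L Hdm Cb B0 Hav (e1 & He1 & Hdep) Hth Hodd.
assert (PP := PI_RGT_0).
destruct (continuous_near th 0 (PI / 4)) as (e2 & He2 & N0);
  [lra|apply Hth; unfold segment; lra|].
destruct (continuous_near th 1 (PI / 4)) as (e3 & He3 & N1);
  [lra|apply Hth; unfold segment; lra|].
destruct (positive_below_four (/ 2) e1 e2 e3) as (eta & E0 & E1 & E2 & E3 & E4); try lra.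
set (F := fun z : R * R => sub (c (snd z)) (b (fst z))).
destruct (angle_on_rect F 0 dm (s0 + eta) (s0 - eta + 1)) as [Th HTh]; try lra.
{ intros [d s] [H1 H2]; cbn in H1, H2; split.
  - apply plane_continuous_sub.
    + apply (plane_continuous_comp (snd : R * R -> R) c);
      [apply continuous_snd|apply (loop_continuous _ _ L)].
    + apply (plane_continuous_comp (fst : R * R -> R) b); [apply continuous_fst|now apply Cb].
  - unfold F; cbn [fst snd]; intros E; apply sub_eq_0 in E.
    destruct (Req_dec d 0) as [->|Hd].
    + rewrite B0 in E; apply (loop_simple _ _ L s0 (s - s0)); [lra|].
      now replace (s0 + (s - s0)) with s by ring.
    + apply (Hav d s); [lra|easy]. }
assert (ThC : forall s, s0 + eta <= s <= s0 - eta + 1 -> continuous (fun d => Th (d, s)) 0).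
{ intros s Hs; apply (continuous_comp (fun d : R => (d, s)) Th).
  - apply continuous_pair; [apply continuous_id|apply continuous_const].
  - apply HTh; split; cbn; lra. }
destruct (continuous_near (fun d => Th (d, s0 + eta)) 0 (PI / 4)) as (e4 & He4 & N2);
  [lra|apply ThC; lra|].
destruct (continuous_near (fun d => Th (d, s0 - eta + 1)) 0 (PI / 4)) as (e5 & He5 & N3);
  [lra|apply ThC; lra|].
destruct (positive_below_four dm e1 e4 e5) as (d0 & F0 & F1 & F2 & F3 & F4); auto.
exists eta, d0; split; [lra|split; [lra|]]; intros d ps Hd Hps.
assert (Ab : forall y, 0 <= y -> Rabs y = y) by (intros; now apply Rabs_pos_eq).
specialize (N0 eta); rewrite Rminus_0_r, (Ab eta) in N0 by lra; specialize (N0 E3).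
specialize (N1 (1 - eta)); replace (1 - eta - 1) with (- eta) in N1 by ring.
rewrite Rabs_Ropp, (Ab eta) in N1 by lra; specialize (N1 E4).
specialize (N2 d); specialize (N3 d); rewrite Rminus_0_r, (Ab d) in N2, N3 by lra.
specialize (N2 ltac:(lra)); specialize (N3 ltac:(lra)).
(* For [d = 0] the map [F] is, up to positive factors, the chord from [c s0]. *)
assert (Q0 : Th (0, s0 - eta + 1) - Th (0, s0 + eta) = th (1 - eta) - th eta).
{ transitivity ((fun s => th (s - s0)) (s0 - eta + 1) - (fun s => th (s - s0)) (s0 + eta)).
  2: replace (s0 - eta + 1 - s0) with (1 - eta) by ring;
     now replace (s0 + eta - s0) with eta by ring.
  apply (angle_change_unique (fun s => sub (c s) (c s0)) (fun s => Th (0, s))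
      (fun s => th (s - s0))); [lra| |].
  - intros s Hs; destruct (HTh (0, s)) as [H1 H2]; [split; cbn; unfold segment in Hs; lra|].
    split.
    + apply (continuous_comp (fun s : R => (0, s)) Th); [|easy].
      apply continuous_pair; [apply continuous_const|apply continuous_id].
    + unfold F in H2; cbn [fst snd] in H2; now rewrite B0 in H2.
  - intros s Hs; unfold segment in Hs.
    destruct (Hth (s - s0)) as [H1 H2]; [unfold segment; lra|]; split.
    + apply (continuous_comp (fun s : R => s - s0) th); [|easy].
      apply continuous_Rminus; [apply continuous_id|apply continuous_const].
    + rewrite (chord_inside c dc L) in H2 by lra.
      set (k := (s - s0) * (1 - (s - s0))) in *.
      assert (Hk : 0 < k) by (unfold k; nra).
      apply (points_at_scale _ _ k Hk) in H2; cbn [fst snd] in H2.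
      replace (s0 + (s - s0)) with s in H2 by lra.
      rewrite <- !Rmult_assoc, !Rinv_r, !Rmult_1_l in H2 by lra.
      now rewrite <- surjective_pairing in H2. }
assert (Q1 : ps (s0 - eta + 1) - ps (s0 + eta) = Th (d, s0 - eta + 1) - Th (d, s0 + eta)).
{ apply (angle_change_unique (fun s => sub (c s) (b d)) ps (fun s => Th (d, s))); [lra| |].
  - eapply angle_on_sub; [|exact Hps]; unfold segment; intros; lra.
  - intros s Hs; destruct (HTh (d, s)) as [H1 H2]; [split; cbn; unfold segment in Hs; lra|].
    split; [|exact H2].
    apply (continuous_comp (fun s : R => (d, s)) Th); [|easy].
    apply continuous_pair; [apply continuous_const|apply continuous_id]. }
(* The reference direction is that from [b d] to [c s0]: the determinants of
   [departs] are those of this direction and the curve seen from [b d]. *)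
assert (exists J, ps (s0 + eta) - ps (s0 - eta) = J /\ ka * J < 0 /\ - (2 * PI) < J < 2 * PI)
  as (J & Q2 & Jk & JB).
{ assert (Hu : sub (c s0) (b d) <> (0, 0)).
  { intros E; apply sub_eq_0 in E; apply (Hav d s0); [lra|easy]. }
  destruct (window_turning (fun s => sub (c s) (b d)) s0 eta (sub (c s0) (b d)) (- ka))
    as (w & W1 & W2 & W3); auto.
  - intros s Hs; apply plane_continuous_sub;
      [apply (loop_continuous _ _ L)|apply plane_continuous_const].
  - intros s Hs Hn; unfold segment in Hs.
    specialize (Hdep d s ltac:(lra) Hn ltac:(lra)).
    replace (- ka * _)
      with (ka * ((s - s0) * det (sub (b d) (c s0)) (sub (c s) (c s0)))); [easy|].
    unfold det, sub; cbn; ring.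
  - rewrite <- len_sqr; apply len_pos in Hu; nra.
  - exists (w (s0 + eta) - w (s0 - eta)); split; [|split; [nra|easy]].
    apply (angle_change_unique (fun s => sub (c s) (b d)) ps w); [lra| |easy].
    eapply angle_on_sub; [|exact Hps]; unfold segment; intros; lra. }
assert (exists m : Z, ps (s0 - eta + 1) - ps (s0 - eta) = 2 * PI * IZR m) as [m Hm].
{ apply points_at_unique with (sub (c (s0 - eta)) (b d)).
  - rewrite <- (loop_periodic _ _ L); apply Hps; unfold segment; lra.
  - apply Hps; unfold segment; lra. }
destruct Hodd as [k Hk].
apply Rabs_def2 in N0; apply Rabs_def2 in N1; apply Rabs_def2 in N2; apply Rabs_def2 in N3.
set (W := ps (s0 - eta + 1) - ps (s0 - eta)) in *; set (h := th 1 - th 0) in *.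
assert (Close : - PI < W - h - J < PI) by (unfold W, h; lra).
destruct (Rtotal_order ka 0) as [Hka|[->|Hka]]; [|lra|].
- assert (0 < J) by nra.
  assert (G1 : IZR 0 < IZR (m - k)) by (rewrite minus_IZR; nra).
  assert (G2 : IZR (m - k) < IZR 2) by (rewrite minus_IZR; nra).
  apply lt_IZR in G1, G2; replace m with (k + 1)%Z in Hm by lia.
  rewrite plus_IZR in Hm; nra.
- assert (J < 0) by nra.
  assert (G1 : IZR (-1) < IZR (m - k)) by (rewrite minus_IZR; nra).
  assert (G2 : IZR (m - k) < IZR 1) by (rewrite minus_IZR; nra).
  apply lt_IZR in G1, G2; replace m with k in Hm by lia; nra.
Qed.

(** * Two crossings of an arc with a closed curve *)

(** Jordan separation for an arc meeting a simple closed curve at its two ends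
    only: it departs on the same side from both ends.  The turning [W] of the curve
    seen from a point is constant along the interior of the arc, the turning [h] of
    the chord is constant along the curve, and [turning_jump] reads off the side
    from [h - W] at each end. *)
Lemma same_side_at_both_ends c dc a t0 t1 s0 s1 k0 k1 :
  simple_loop c dc -> t0 < t1 -> 0 <= s0 <= 1 -> 0 <= s1 <= 1 ->
  (forall t, t0 <= t <= t1 -> plane_continuous a t) ->
  a t0 = c s0 -> a t1 = c s1 ->
  (forall t s, t0 < t < t1 -> c s <> a t) ->
  departs k0 c s0 (fun d => a (t0 + d)) ->
  departs k1 c s1 (fun d => a (t1 - d)) ->
  0 < k0 * k1.
Proof.
intros L Ht Hs0 Hs1 Ca A0 A1 Hav D0 D1.
destruct (chord_turning c dc L) as (h & Hodd & Hh).
destruct (Hh s0 Hs0) as (th0 & T0 & E0); destruct (Hh s1 Hs1) as (th1 & T1 & E1).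
assert (Hdm : 0 < (t1 - t0) / 2) by lra.
destruct (turning_jump c dc s0 (fun d => a (t0 + d)) ((t1 - t0) / 2) k0 th0)
  as (n0 & d0 & N0 & P0 & J0); auto.
{ intros d Hd; apply (plane_continuous_comp (fun d : R => t0 + d) a); [|apply Ca; lra].
  apply continuous_Rplus; [apply continuous_const|apply continuous_id]. }
{ now rewrite Rplus_0_r. }
{ intros d s Hd; apply Hav; lra. }
{ now rewrite E0. }
destruct (turning_jump c dc s1 (fun d => a (t1 - d)) ((t1 - t0) / 2) k1 th1)
  as (n1 & d1 & N1 & P1 & J1); auto.
{ intros d Hd; apply (plane_continuous_comp (fun d : R => t1 - d) a); [|apply Ca; lra].
  apply continuous_Rminus; [apply continuous_const|apply continuous_id]. }
{ now rewrite Rminus_0_r. }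
{ intros d s Hd; apply Hav; lra. }
{ now rewrite E1. }
set (d := Rmin d0 d1).
assert (Pd : 0 < d) by (apply Rmin_pos; lra).
assert (d <= d0) by apply Rmin_l; assert (d <= d1) by apply Rmin_r.
destruct (angle_on_rect (fun z => sub (c (snd z)) (a (fst z))) (t0 + d) (t1 - d) (-1) 2)
  as [ps Hps]; try lra.
{ intros [u s] [H1 H2]; cbn in H1, H2; split.
  - apply plane_continuous_sub.
    + apply (plane_continuous_comp (snd : R * R -> R) c);
      [apply continuous_snd|apply (loop_continuous _ _ L)].
    + apply (plane_continuous_comp (fst : R * R -> R) a); [apply continuous_fst|apply Ca; cbn; lra].
  - cbn [fst snd]; intros E; apply sub_eq_0 in E; apply (Hav u s); [lra|easy]. }
set (W := fun u s : R => ps (u, s + 1) - ps (u, s)).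
assert (WZ : forall u s, t0 + d <= u <= t1 - d -> -1 <= s <= 1 ->
  exists k : Z, W u s = 0 + 2 * PI * IZR k).
{ intros u s Hu Hs.
  destruct (points_at_unique (ps (u, s + 1)) (ps (u, s)) (sub (c s) (a u))) as [k E].
  - rewrite <- (loop_periodic _ _ L); apply (Hps (u, s + 1)); split; cbn; lra.
  - apply (Hps (u, s)); split; cbn; lra.
  - exists k; rewrite Rplus_0_l; exact E. }
assert (Wu : forall s, -1 <= s <= 1 -> W (t0 + d) s = W (t1 - d) s).
{ intros s Hs; apply (constant_of_discrete (fun u => W u s)) with (al := 0); [lra| |auto].
  intros u Hu; apply continuous_Rminus;
    [apply (continuous_comp (fun u : R => (u, s + 1)) ps)
    |apply (continuous_comp (fun u : R => (u, s)) ps)];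
    try (apply continuous_pair; [apply continuous_id|apply continuous_const]);
    apply Hps; split; cbn; lra. }
assert (Ws : forall u s, t0 + d <= u <= t1 - d -> -1 <= s <= 1 -> W u (-1) = W u s).
{ intros u s Hu Hs; apply (constant_of_discrete (W u)) with (al := 0); [lra| |intros; apply WZ; lra].
  intros x Hx; apply continuous_Rminus.
  - apply (continuous_comp (fun s : R => (u, s + 1)) ps).
    + apply continuous_pair; [apply continuous_const|].
      apply continuous_Rplus; [apply continuous_id|apply continuous_const].
    + apply Hps; split; cbn; lra.
  - apply (continuous_comp (fun s : R => (u, s)) ps).
    + apply continuous_pair; [apply continuous_const|apply continuous_id].
    + apply Hps; split; cbn; lra. }
assert (Hrow : forall u x, t0 + d <= u <= t1 - d -> -1 <= x <= 1 ->
  angle_on (segment x (x + 1)) (fun s => sub (c s) (a u)) (fun s => ps (u, s))).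
{ intros u x Hu Hx s Hs; unfold segment in Hs.
  destruct (Hps (u, s)) as [H1 H2]; [split; cbn; lra|split; [|exact H2]].
  apply (continuous_comp (fun s : R => (u, s)) ps); [|easy].
  apply continuous_pair; [apply continuous_const|apply continuous_id]. }
specialize (J0 d (fun s => ps (t0 + d, s)) ltac:(lra)
  (Hrow (t0 + d) (s0 - n0) ltac:(lra) ltac:(lra))).
specialize (J1 d (fun s => ps (t1 - d, s)) ltac:(lra)
  (Hrow (t1 - d) (s1 - n1) ltac:(lra) ltac:(lra))).
rewrite E0 in J0; rewrite E1 in J1.
change (0 < k0 * (h - W (t0 + d) (s0 - n0))) in J0.
change (0 < k1 * (h - W (t1 - d) (s1 - n1))) in J1.
rewrite <- Ws in J0, J1 by lra; rewrite <- Wu in J1 by lra.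
set (x := h - W (t0 + d) (-1)) in *.
assert (0 < (k0 * k1) * (x * x)) by nra.
assert (0 <= x * x) by nra; nra.
Qed.

(** The difference quotient from a fixed point [x], with the derivative [l] at [x]. *)
Definition slope (f : R -> R) (x l y : R) : R :=
  if Req_EM_T y x then l else (f y - f x) / (y - x).

Lemma continuous_slope f x l : is_derive f x l -> continuous (slope f x l) x.
Proof.
intros H; apply is_derive_Reals in H.
apply filterlim_locally; intros eps.
destruct (H eps (cond_pos eps)) as [del Hdel]; exists del; intros y Hy.
change (Rabs (y - x) < del) in Hy.
change (Rabs (slope f x l y - slope f x l x) < eps).
unfold slope; destruct (Req_EM_T x x); [|easy].
destruct (Req_EM_T y x) as [|Hn].
- rewrite Rminus_diag, Rabs_R0; apply cond_pos.
- specialize (Hdel (y - x)); replace (x + (y - x)) with y in Hdel by lra.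
  apply Hdel; [lra|easy].
Qed.

(** The determinant in [departs] is [(s - s0) * d] times that of two slopes, which is
    close to [det w v]. *)
Lemma departs_of_derive (c : R -> R * R) s0 v (b : R -> R * R) w :
  b 0 = c s0 ->
  is_derive (fun s => fst (c s)) s0 (fst v) ->
  is_derive (fun s => snd (c s)) s0 (snd v) ->
  is_derive (fun d => fst (b d)) 0 (fst w) ->
  is_derive (fun d => snd (b d)) 0 (snd w) ->
  det w v <> 0 -> departs (det w v) c s0 b.
Proof.
intros B0 V1 V2 W1 W2 Hdet.
set (Q := fun z : R * R =>
  det (slope (fun d => fst (b d)) 0 (fst w) (fst z),
       slope (fun d => snd (b d)) 0 (snd w) (fst z))
      (slope (fun s => fst (c s)) s0 (fst v) (snd z),
       slope (fun s => snd (c s)) s0 (snd v) (snd z))).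
assert (CQ : continuous Q (0, s0)).
{ apply continuous_det; split; cbn [fst snd].
  1,2: apply (continuous_comp (fst : R * R -> R)); [apply continuous_fst|now apply continuous_slope].
  1,2: apply (continuous_comp (snd : R * R -> R)); [apply continuous_snd|now apply continuous_slope]. }
assert (Q0 : Q (0, s0) = det w v).
{ unfold Q, slope; cbn [fst snd]; destruct (Req_EM_T 0 0), (Req_EM_T s0 s0); try easy. }
assert (Pk : 0 < Rabs (det w v)) by now apply Rabs_pos_lt.
destruct (proj1 (filterlim_locally _ _) CQ (mkposreal _ Pk)) as [del Hdel].
exists (del / 2); pose proof (cond_pos del); split; [lra|].
intros d s Hd Hs Hs'.
assert (B : Rabs (Q (d, s) - Q (0, s0)) < Rabs (det w v)).
{ apply (Hdel (d, s)); split; cbn.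
  - change (Rabs (d - 0) < del); apply Rabs_def1; lra.
  - change (Rabs (s - s0) < del); apply Rabs_def1; lra. }
rewrite Q0 in B.
assert (E : (s - s0) * det (sub (b d) (c s0)) (sub (c s) (c s0)) = ((s - s0) * (s - s0)) * d * Q (d, s)).
{ unfold Q, slope; cbn [fst snd].
  destruct (Req_EM_T d 0); [lra|]; destruct (Req_EM_T s s0); [easy|].
  rewrite B0; unfold det, sub; cbn [fst snd]; field; lra. }
rewrite E.
assert (S : 0 < (s - s0) * (s - s0)) by nra.
assert (KQ : 0 < det w v * Q (d, s)).
{ unfold Rabs in B; destruct (Rcase_abs (Q (d, s) - det w v)), (Rcase_abs (det w v)); nra. }
replace (_ * _) with ((s - s0) * (s - s0) * d * (det w v * Q (d, s))) by ring.
apply Rmult_lt_0_compat; [apply Rmult_lt_0_compat; [exact S|lra]|exact KQ].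
Qed.

(** * Stereographic projection of spherical curves *)

Definition dot3 (u v : vec3) : R := cx u * cx v + cy u * cy v + cz u * cz v.
Definition triple (u v w : vec3) : R := dot3 u (cross v w).
Definition sub3 (u v : vec3) : vec3 := Vec3 (cx u - cx v) (cy u - cy v) (cz u - cz v).

(** A positively oriented orthonormal basis, orthonormality being expressed by the
    formula for the dot product in coordinates. *)
Record frame (e1 e2 n : vec3) : Prop := {
  frame_cross_12 : cross e1 e2 = n;
  frame_cross_2n : cross e2 n = e1;
  frame_cross_n1 : cross n e1 = e2;
  frame_dot : forall u v,
    dot3 u v = dot3 e1 u * dot3 e1 v + dot3 e2 u * dot3 e2 v + dot3 n u * dot3 n v }.

(** The formula rotates the standard basis by the shortest rotation taking the north
    pole to [n]; it breaks down when [n] is the south pole. *)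
Lemma frame_exists n : on_S2 n -> exists e1 e2, frame e1 e2 n.
Proof.
destruct n as [p q r]; unfold on_S2; cbn [cx cy cz]; intros H.
destruct (Req_dec (1 + r) 0) as [Hr|Hr].
- assert (r = -1) by lra; subst r.
  assert (p = 0) by nra; assert (q = 0) by nra; subst.
  exists (Vec3 1 0 0), (Vec3 0 (-1) 0); split; unfold cross, dot3; cbn.
  1-3: f_equal; ring.
  intros; ring.
- set (k := / (1 + r)).
  assert (Hk : k * (1 + r) = 1) by (unfold k; field; easy).
  clearbody k.
  assert (H' : p * p + q * q + r * r = 1) by lra; clear H.
  exists (Vec3 (1 - k * p * p) (- k * p * q) (- p)), (Vec3 (- k * p * q) (1 - k * q * q) (- q)).
  split; unfold cross, dot3; cbn [cx cy cz].
  1-3: f_equal; nsatz.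
  intros [x y z] [x' y' z']; cbn [cx cy cz]; nsatz.
Qed.

Lemma dot3_eq_0 u : dot3 u u = 0 -> u = Vec3 0 0 0.
Proof. destruct u as [x y z]; unfold dot3; cbn; intros H; f_equal; nra. Qed.

Lemma cross_parallel x u v :
  on_S2 x -> dot3 x u = 0 -> dot3 x v = 0 ->
  cross u v = Vec3 (triple x u v * cx x) (triple x u v * cy x) (triple x u v * cz x).
Proof.
destruct x as [x1 x2 x3], u as [u1 u2 u3], v as [v1 v2 v3].
unfold on_S2, triple, dot3, cross; cbn [cx cy cz]; intros H H1 H2.
assert (H' : x1 * x1 + x2 * x2 + x3 * x3 = 1) by lra; clear H.
f_equal; nsatz.
Qed.

Lemma on_S2_dot3 x : on_S2 x -> dot3 x x = 1.
Proof. unfold on_S2, dot3; intros H; lra. Qed.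

Lemma pole_den_neq_0 n x : on_S2 n -> on_S2 x -> x <> n -> 1 - dot3 n x <> 0.
Proof.
intros Hn Hx Hne E; apply Hne.
assert (E' : dot3 (sub3 x n) (sub3 x n) = 0).
{ apply on_S2_dot3 in Hn, Hx; unfold dot3, sub3 in *; cbn; lra. }
apply dot3_eq_0 in E'; destruct x, n; injection E' as H1 H2 H3; cbn in *; f_equal; lra.
Qed.

Section Stereographic.
Variables e1 e2 n : vec3.
Hypothesis Fr : frame e1 e2 n.

(** Stereographic projection from the pole [n]. *)
Definition stereo (x : vec3) : R * R :=
  (dot3 e1 x / (1 - dot3 n x), dot3 e2 x / (1 - dot3 n x)).

(** The differential of [stereo] at [x] applied to [v]. *)
Definition dstereo (x v : vec3) : R * R :=
  ((dot3 e1 v * (1 - dot3 n x) - dot3 e1 x * - dot3 n v) / (1 - dot3 n x) ^ 2,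
   (dot3 e2 v * (1 - dot3 n x) - dot3 e2 x * - dot3 n v) / (1 - dot3 n x) ^ 2).

(** The third coordinate of [x] is recovered from the squared length of its image,
    which is [(1 + c) / (1 - c)]. *)
Lemma stereo_injective x y :
  on_S2 n -> on_S2 x -> on_S2 y -> x <> n -> y <> n -> stereo x = stereo y -> x = y.
Proof.
intros Hn Hx Hy Nx Ny E; injection E as E1 E2.
assert (Dx := pole_den_neq_0 n x Hn Hx Nx); assert (Dy := pole_den_neq_0 n y Hn Hy Ny).
assert (Px := frame_dot _ _ _ Fr x x); assert (Py := frame_dot _ _ _ Fr y y).
rewrite on_S2_dot3 in Px, Py by easy.
set (a := dot3 e1 x) in *; set (b := dot3 e2 x) in *; set (c := dot3 n x) in *.
set (a' := dot3 e1 y) in *; set (b' := dot3 e2 y) in *; set (c' := dot3 n y) in *.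
set (i := / (1 - c)); set (i' := / (1 - c')).
assert (I : i * (1 - c) = 1) by (unfold i; field; easy).
assert (I' : i' * (1 - c') = 1) by (unfold i'; field; easy).
unfold Rdiv in E1, E2; fold i i' in E1, E2.
assert (S : (a * i) * (a * i) + (b * i) * (b * i) = i * (1 + c)).
{ transitivity (i * i * (1 - c * c)); [rewrite Px; ring|].
  transitivity (i * (1 - c) * (i * (1 + c))); [ring|rewrite I; ring]. }
assert (S' : (a' * i') * (a' * i') + (b' * i') * (b' * i') = i' * (1 + c')).
{ transitivity (i' * i' * (1 - c' * c')); [rewrite Py; ring|].
  transitivity (i' * (1 - c') * (i' * (1 + c'))); [ring|rewrite I'; ring]. }
rewrite E1, E2, S' in S.
assert (Ei : i = i') by nra.
assert (Ni : i <> 0) by (intros E0; rewrite E0 in I; lra).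
rewrite <- Ei in *.
assert (a = a') by now apply Rmult_eq_reg_r in E1.
assert (b = b') by now apply Rmult_eq_reg_r in E2.
assert (c = c') by (apply Rmult_eq_reg_l with i; [lra|easy]).
assert (Lin : forall e, dot3 e (sub3 x y) = dot3 e x - dot3 e y).
{ intros e; unfold dot3, sub3; cbn; ring. }
assert (Z : dot3 (sub3 x y) (sub3 x y) = 0).
{ rewrite (frame_dot _ _ _ Fr), !Lin; fold a a' b b' c c'; nra. }
apply dot3_eq_0 in Z; destruct x, y; injection Z as Z1 Z2 Z3; f_equal; lra.
Qed.

Lemma dstereo_neq_0 x v :
  on_S2 x -> 1 - dot3 n x <> 0 -> dot3 x v = 0 -> v <> Vec3 0 0 0 ->
  dstereo x v <> (0, 0).
Proof.
intros Hx Dx Hxv Hv E; injection E as E1 E2; apply Hv, dot3_eq_0.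
assert (Px := frame_dot _ _ _ Fr x x); assert (Pv := frame_dot _ _ _ Fr v v).
assert (Pxv := frame_dot _ _ _ Fr x v).
rewrite on_S2_dot3 in Px by easy; rewrite Hxv in Pxv; rewrite Pv.
set (a := dot3 e1 x) in *; set (b := dot3 e2 x) in *; set (c := dot3 n x) in *.
set (a' := dot3 e1 v) in *; set (b' := dot3 e2 v) in *; set (c' := dot3 n v) in *.
assert (Z : forall p, p / (1 - c) ^ 2 = 0 -> p = 0).
{ intros p Hp; replace p with (p / (1 - c) ^ 2 * (1 - c) ^ 2) by (field; easy).
  rewrite Hp; ring. }
apply Z in E1; apply Z in E2.
assert (C0 : (1 - c) * c' = 0) by nsatz.
apply Rmult_integral in C0; destruct C0 as [C0|C0]; [easy|].
rewrite C0 in *.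
assert (A0 : a' * (1 - c) = 0) by lra; assert (B0 : b' * (1 - c) = 0) by lra.
apply Rmult_integral in A0; apply Rmult_integral in B0.
destruct A0 as [A0|]; [|easy]; destruct B0 as [B0|]; [|easy].
rewrite A0, B0; ring.
Qed.

(** Stereographic projection is conformal with factor [1 / (1 - dot3 n x)] on tangent
    vectors, and reverses the orientation. *)
Lemma det_dstereo x u v :
  on_S2 x -> 1 - dot3 n x <> 0 -> dot3 x u = 0 -> dot3 x v = 0 ->
  det (dstereo x u) (dstereo x v) = - triple x u v / (1 - dot3 n x) ^ 2.
Proof.
intros Hx Dx Hu Hv.
assert (C := cross_parallel x u v Hx Hu Hv).
assert (Px := frame_dot _ _ _ Fr x x); rewrite on_S2_dot3 in Px by easy.
assert (K : forall e, dot3 e (cross u v) = triple x u v * dot3 e x).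
{ intros e; rewrite C; unfold dot3; cbn; ring. }
assert (Bin : forall e f, dot3 (cross e f) (cross u v) = dot3 e u * dot3 f v - dot3 f u * dot3 e v).
{ intros e f; unfold dot3, cross; cbn; ring. }
assert (K1 := Bin e1 e2); assert (K2 := Bin e2 n); assert (K3 := Bin n e1).
rewrite (frame_cross_12 _ _ _ Fr), K in K1.
rewrite (frame_cross_2n _ _ _ Fr), K in K2.
rewrite (frame_cross_n1 _ _ _ Fr), K in K3.
unfold det, dstereo; cbn [fst snd].
set (a := dot3 e1 x) in *; set (b := dot3 e2 x) in *; set (c := dot3 n x) in *.
set (au := dot3 e1 u) in *; set (bu := dot3 e2 u) in *; set (cu := dot3 n u) in *.
set (av := dot3 e1 v) in *; set (bv := dot3 e2 v) in *; set (cv := dot3 n v) in *.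
set (l := triple x u v) in *.
assert (P : (au * (1 - c) - a * - cu) * (bv * (1 - c) - b * - cv)
          - (bu * (1 - c) - b * - cu) * (av * (1 - c) - a * - cv) = - l * ((1 - c) * (1 - c))) by nsatz.
transitivity (- l * ((1 - c) * (1 - c)) / (1 - c) ^ 4); [rewrite <- P; field; easy|field; easy].
Qed.

End Stereographic.

Lemma is_derive_Rmult (f g : R -> R) x df dg :
  is_derive f x df -> is_derive g x dg ->
  is_derive (fun t => f t * g t) x (df * g x + f x * dg).
Proof.
intros Hf Hg.
apply (is_derive_mult (K := R_AbsRing) f g x df dg Hf Hg); intros; apply Rmult_comm.
Qed.

Section SphereCurve.
Variable g : R -> vec3.
Hypothesis Hs : smooth g.

Lemma smooth_derive t :
  is_derive (fun s => cx (g s)) t (cx (velocity g t)) /\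
  is_derive (fun s => cy (g s)) t (cy (velocity g t)) /\
  is_derive (fun s => cz (g s)) t (cz (velocity g t)).
Proof.
destruct (Hs 1%nat t) as (H1 & H2 & H3).
repeat split; cbn; apply Derive_correct; assumption.
Qed.

Lemma smooth_continuous_velocity t :
  continuous (fun s => cx (velocity g s)) t /\
  continuous (fun s => cy (velocity g s)) t /\
  continuous (fun s => cz (velocity g s)) t.
Proof.
destruct (Hs 2%nat t) as (H1 & H2 & H3).
repeat split; cbn; apply (ex_derive_continuous (K := R_AbsRing) (V := R_NormedModule)); assumption.
Qed.

Lemma is_derive_dot3 e t : is_derive (fun s => dot3 e (g s)) t (dot3 e (velocity g t)).
Proof.
destruct (smooth_derive t) as (H1 & H2 & H3).
apply (is_derive_plus (V := R_NormedModule)); [apply (is_derive_plus (V := R_NormedModule))|];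
  apply (is_derive_scal (fun s => _ (g s))); assumption.
Qed.

Lemma continuous_dot3_velocity e t : continuous (fun s => dot3 e (velocity g s)) t.
Proof.
destruct (smooth_continuous_velocity t) as (H1 & H2 & H3).
apply continuous_Rplus; [apply continuous_Rplus|];
  apply continuous_Rmult; solve [apply continuous_const|assumption].
Qed.

Lemma continuous_dot3 e t : continuous (fun s => dot3 e (g s)) t.
Proof.
apply (ex_derive_continuous (K := R_AbsRing) (V := R_NormedModule)).
eexists; apply is_derive_dot3.
Qed.

Lemma velocity_tangent t : (forall s, on_S2 (g s)) -> dot3 (g t) (velocity g t) = 0.
Proof.
intros H.
destruct (smooth_derive t) as (H1 & H2 & H3).
assert (D : is_derive (fun s => cx (g s) * cx (g s) + cy (g s) * cy (g s) + cz (g s) * cz (g s)) t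
  (2 * dot3 (g t) (velocity g t))).
{ unfold dot3; evar_last.
  - apply (is_derive_plus (V := R_NormedModule)); 
      [apply (is_derive_plus (V := R_NormedModule))|].
    1-3: apply is_derive_Rmult; eassumption.
  - unfold plus, mult; cbn; ring. }
apply is_derive_unique in D.
rewrite (Derive_ext _ (fun _ => 1)), Derive_const in D; [lra|].
intros s; specialize (H s); unfold on_S2 in H; lra.
Qed.

Variables e1 e2 n : vec3.

Lemma is_derive_stereo t : 1 - dot3 n (g t) <> 0 ->
  is_derive (fun s => fst (stereo e1 e2 n (g s))) t (fst (dstereo e1 e2 n (g t) (velocity g t))) /\
  is_derive (fun s => snd (stereo e1 e2 n (g s))) t (snd (dstereo e1 e2 n (g t) (velocity g t))).
Proof.
intros H.
assert (D : is_derive (fun s => 1 - dot3 n (g s)) t (- dot3 n (velocity g t))).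
{ evar_last.
  - apply (is_derive_minus (V := R_NormedModule)); [apply is_derive_const|apply is_derive_dot3].
  - unfold minus, plus, opp, zero; cbn; ring. }
split.
- apply (is_derive_div (fun s => dot3 e1 (g s)) (fun s => 1 - dot3 n (g s))); auto;
    apply is_derive_dot3.
- apply (is_derive_div (fun s => dot3 e2 (g s)) (fun s => 1 - dot3 n (g s))); auto;
    apply is_derive_dot3.
Qed.

Lemma plane_continuous_dstereo t : 1 - dot3 n (g t) <> 0 ->
  plane_continuous (fun s => dstereo e1 e2 n (g s) (velocity g s)) t.
Proof.
intros H.
assert (D : continuous (fun s => 1 - dot3 n (g s)) t).
{ apply continuous_Rminus; [apply continuous_const|apply continuous_dot3]. }
split; cbn [fst snd dstereo]; apply continuous_Rdiv.
1,4: apply continuous_Rminus; apply continuous_Rmult; auto using continuous_dot3, continuous_dot3_velocity;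
  apply (continuous_opp (V := R_NormedModule)); apply continuous_dot3_velocity.
1,3: apply continuous_Rmult; [exact D|apply continuous_Rmult; [exact D|apply continuous_const]].
all: now apply pow_nonzero.
Qed.

End SphereCurve.

(** The spherical form of [same_side_at_both_ends], obtained by projecting from a
    point [n] off both curves.  At the end [t1] the arc is traversed backwards, so
    departing on the same side means crossing with opposite signs. *)
Lemma crossing_sign_alternates g1 g2 n t0 t1 s0 s1 :
  smooth g1 -> smooth g2 -> (forall t, on_S2 (g1 t)) -> (forall t, on_S2 (g2 t)) ->
  (forall s, g2 (s + 1) = g2 s) -> (forall s, velocity g2 s <> Vec3 0 0 0) ->
  (forall s t, 0 < t < 1 -> g2 (s + t) <> g2 s) ->
  on_S2 n -> (forall s, g2 s <> n) -> (forall t, t0 <= t <= t1 -> g1 t <> n) ->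
  t0 < t1 -> 0 <= s0 <= 1 -> 0 <= s1 <= 1 ->
  g1 t0 = g2 s0 -> g1 t1 = g2 s1 ->
  (forall t s, t0 < t < t1 -> g2 s <> g1 t) ->
  triple (g1 t0) (velocity g1 t0) (velocity g2 s0) <> 0 ->
  triple (g1 t1) (velocity g1 t1) (velocity g2 s1) <> 0 ->
  triple (g1 t0) (velocity g1 t0) (velocity g2 s0) *
  triple (g1 t1) (velocity g1 t1) (velocity g2 s1) < 0.
Proof.
intros S1 S2 O1 O2 Per Reg Sim Hn N2 N1 Ht Hs0 Hs1 E0 E1 Hav T0 T1.
destruct (frame_exists n Hn) as (e1 & e2 & Fr).
set (st := stereo e1 e2 n); set (dst := dstereo e1 e2 n).
assert (D2 : forall s, 1 - dot3 n (g2 s) <> 0) by (intros; apply pole_den_neq_0; auto).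
assert (D1 : forall t, t0 <= t <= t1 -> 1 - dot3 n (g1 t) <> 0) by (intros; apply pole_den_neq_0; auto).
assert (X2 : forall s, dot3 (g2 s) (velocity g2 s) = 0) by (intros; now apply velocity_tangent).
assert (X1 : forall s, dot3 (g1 s) (velocity g1 s) = 0) by (intros; now apply velocity_tangent).
assert (L : simple_loop (fun s => st (g2 s)) (fun s => dst (g2 s) (velocity g2 s))).
{ split.
  - intros s; now apply is_derive_stereo.
  - intros s; now apply is_derive_stereo.
  - intros s; now apply plane_continuous_dstereo.
  - intros s; now apply (dstereo_neq_0 e1 e2 n Fr).
  - intros s; now rewrite Per.
  - intros s t H E; apply (stereo_injective e1 e2 n Fr) in E; auto; now apply (Sim s t). }
assert (Det0 := det_dstereo e1 e2 n Fr (g1 t0) (velocity g1 t0) (velocity g2 s0) (O1 t0)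
  (D1 t0 ltac:(lra)) (X1 t0) ltac:(rewrite E0; apply X2)).
assert (Det1 := det_dstereo e1 e2 n Fr (g1 t1) (velocity g1 t1) (velocity g2 s1) (O1 t1)
  (D1 t1 ltac:(lra)) (X1 t1) ltac:(rewrite E1; apply X2)).
assert (P0 : 0 < / (1 - dot3 n (g1 t0)) ^ 2) by (apply Rinv_0_lt_compat, pow2_gt_0, D1; lra).
assert (P1 : 0 < / (1 - dot3 n (g1 t1)) ^ 2) by (apply Rinv_0_lt_compat, pow2_gt_0, D1; lra).
set (w0 := dst (g1 t0) (velocity g1 t0)).
set (w1 := dst (g1 t1) (velocity g1 t1)).
set (v0 := dst (g2 s0) (velocity g2 s0)).
set (v1 := dst (g2 s1) (velocity g2 s1)).
assert (DA : forall t, t0 <= t <= t1 ->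
  is_derive (fun s => fst (st (g1 s))) t (fst (dst (g1 t) (velocity g1 t))) /\
  is_derive (fun s => snd (st (g1 s))) t (snd (dst (g1 t) (velocity g1 t)))).
{ intros t H; now apply is_derive_stereo; auto. }
assert (K0 : det w0 v0 = - triple (g1 t0) (velocity g1 t0) (velocity g2 s0) / (1 - dot3 n (g1 t0)) ^ 2).
{ unfold v0; rewrite <- E0; exact Det0. }
assert (K1 : det w1 v1 = - triple (g1 t1) (velocity g1 t1) (velocity g2 s1) / (1 - dot3 n (g1 t1)) ^ 2).
{ unfold v1; rewrite <- E1; exact Det1. }
assert (Nd1 : det (- fst w1, - snd w1) v1 = - det w1 v1) by (unfold det; cbn; ring).
unfold Rdiv in K0, K1.
assert (Pos : 0 < det w0 v0 * det (- fst w1, - snd w1) v1).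
{ apply (same_side_at_both_ends (fun s => st (g2 s)) (fun s => dst (g2 s) (velocity g2 s))
    (fun t => st (g1 t)) t0 t1 s0 s1); auto.
  - intros t H; destruct (DA t H) as [A1 A2]; split;
      apply (ex_derive_continuous (K := R_AbsRing) (V := R_NormedModule)); eexists; eassumption.
  - now rewrite E0.
  - now rewrite E1.
  - intros t s H E; apply (stereo_injective e1 e2 n Fr) in E; auto.
    + now apply (Hav t s).
    + apply N1; lra.
  - destruct (DA t0 ltac:(lra)) as [A1 A2].
    apply departs_of_derive.
    + now rewrite Rplus_0_r, E0.
    + apply (loop_derive_fst _ _ L).
    + apply (loop_derive_snd _ _ L).
    + evar_last; [apply (is_derive_comp (fun s => fst (st (g1 s))) (fun d => t0 + d))|].
      * rewrite Rplus_0_r; exact A1.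
      * apply (is_derive_plus (V := R_NormedModule)); [apply is_derive_const|apply is_derive_id].
      * unfold scal, plus, mult, zero, one; cbn; unfold mult; cbn; fold w0; ring.
    + evar_last; [apply (is_derive_comp (fun s => snd (st (g1 s))) (fun d => t0 + d))|].
      * rewrite Rplus_0_r; exact A2.
      * apply (is_derive_plus (V := R_NormedModule)); [apply is_derive_const|apply is_derive_id].
      * unfold scal, plus, mult, zero, one; cbn; unfold mult; cbn; fold w0; ring.
    + rewrite K0; nra.
  - destruct (DA t1 ltac:(lra)) as [A1 A2].
    apply departs_of_derive.
    + now rewrite Rminus_0_r, E1.
    + apply (loop_derive_fst _ _ L).
    + apply (loop_derive_snd _ _ L).
    + evar_last; [apply (is_derive_comp (fun s => fst (st (g1 s))) (fun d => t1 - d))|].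
      * rewrite Rminus_0_r; exact A1.
      * apply (is_derive_minus (V := R_NormedModule)); [apply is_derive_const|apply is_derive_id].
      * unfold scal, minus, plus, opp, mult, zero, one; cbn; unfold mult; cbn; fold w1; ring.
    + evar_last; [apply (is_derive_comp (fun s => snd (st (g1 s))) (fun d => t1 - d))|].
      * rewrite Rminus_0_r; exact A2.
      * apply (is_derive_minus (V := R_NormedModule)); [apply is_derive_const|apply is_derive_id].
      * unfold scal, minus, plus, opp, mult, zero, one; cbn; unfold mult; cbn; fold w1; ring.
    + rewrite Nd1, K1; nra. }
rewrite Nd1, K0, K1 in Pos.
set (x := triple (g1 t0) _ _) in *; set (y := triple (g1 t1) _ _) in *.
set (p := / (1 - dot3 n (g1 t0)) ^ 2) in *; set (q := / (1 - dot3 n (g1 t1)) ^ 2) in *.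
assert (0 < p * q) by nra.
assert (0 < - (x * y) * (p * q)) by nra.
nra.
Qed.

(** * OU numbers of alternating sequences *)

Definition letter_sign (x : letter) : R := match x with Over => 1 | Under => -1 end.

(** Prepending a letter exchanges the odd and even positions of [s]. *)
Lemma Phi_seq_cons x s : Phi_seq (x :: s) = - / 2 * letter_sign x - Phi_seq s.
Proof.
change (x :: s) with ((x :: nil) ++ s); rewrite Phi_seq_app; cbn [length Nat.even].
destruct x; unfold Phi_seq at 1, occ, occ_from; cbn; lra.
Qed.

Definition sum_over {A} (h : A -> R) (l : list A) : R := fold_right Rplus 0 (map h l).

Lemma sum_over_permutation {A} (h : A -> R) l l' :
  Permutation l l' -> sum_over h l = sum_over h l'.
Proof. unfold sum_over; induction 1; cbn; lra. Qed.

(** Twice the OU number is, up to sign, the sum of the letters (counted as 1 and -1)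
    weighted by the alternating sign of their position; any alternating sign
    [sg] gives the same weights, up to a global sign. *)
Lemma Phi_seq_alternating {A} (f : A -> letter) (sg : A -> R) l :
  (forall x, In x l -> sg x * sg x = 1) ->
  Sorted (fun x y => sg y = - sg x) l ->
  Rabs (Phi_seq (map f l)) = / 2 * Rabs (sum_over (fun x => letter_sign (f x) * sg x) l).
Proof.
intros H1 HS.
assert (Main : match l with nil => True | x :: _ =>
  Phi_seq (map f l) = - / 2 * sg x * sum_over (fun x => letter_sign (f x) * sg x) l end).
{ induction HS as [|x l HS IH Hd]; [easy|].
  assert (Hx := H1 x (or_introl eq_refl)).
  assert (Hc : forall r, r = sg x * sg x * r) by (intros; rewrite Hx; ring).
  cbn [map]; rewrite Phi_seq_cons.
  unfold sum_over in *; cbn [map fold_right].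
  destruct l as [|y l].
  - cbn; change (Phi_seq nil) with (/ 2 * (0 + 0 - 0 - 0)).
    rewrite (Hc (letter_sign (f x))) at 1; ring.
  - rewrite IH by (intros; apply H1; now right).
    inversion Hd as [|? ? E]; subst; rewrite E.
    rewrite (Hc (letter_sign (f x))) at 1; ring. }
destruct l as [|x l].
- unfold sum_over, Phi_seq, occ, occ_from; cbn.
  replace (/ 2 * (0 + 0 - 0 - 0)) with 0 by ring; rewrite Rabs_R0; ring.
- rewrite Main, !Rabs_mult, Rabs_Ropp, (Rabs_pos_eq (/ 2)) by lra.
  assert (E : Rabs (sg x) = 1).
  { specialize (H1 x (or_introl eq_refl)).
    unfold Rabs; destruct (Rcase_abs (sg x)); nra. }
  rewrite E; ring.
Qed.

Lemma strongly_sorted_gap pre a b post :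
  StronglySorted Rlt (pre ++ a :: b :: post) ->
  a < b /\ forall x, In x (pre ++ a :: b :: post) -> ~ a < x < b.
Proof.
induction pre as [|c pre IH]; cbn [app]; intros H; apply StronglySorted_inv in H as [H F].
- apply StronglySorted_inv in H as [_ G]; rewrite Forall_forall in F, G.
  split; [apply F; now left|].
  intros x [<-|[<-|Hx]] Hab; try lra.
  specialize (G x Hx); lra.
- destruct (IH H) as [Hab Hx]; split; [easy|].
  intros x [<-|Hin]; [|now apply Hx].
  rewrite Forall_forall in F; intros Hc.
  assert (c < a) by (apply F, in_or_app; right; now left); lra.
Qed.

Lemma avoid_finite (l : list R) x y : x < y -> exists t, x < t < y /\ ~ In t l.
Proof.
revert x y; induction l as [|a l IH]; intros x y H.
- exists ((x + y) / 2); split; [lra|easy].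
- destruct (Rlt_le_dec a ((x + y) / 2)).
  + destruct (IH ((x + y) / 2) y) as (t & Ht & Hn); [lra|].
    exists t; split; [lra|]; intros [<-|Hi]; [lra|easy].
  + destruct (IH x ((x + y) / 2)) as (t & Ht & Hn); [lra|].
    exists t; split; [lra|]; intros [<-|Hi]; [lra|easy].
Qed.

(** * Signs of the crossings of a diagram *)

Definition other (i : component) : component := match i with K1 => K2 | K2 => K1 end.

Lemma crossing_sym g a b : crossing g a b -> crossing g b a.
Proof. intros (H1 & H2 & H3 & H4); repeat split; try apply H1; try apply H2; auto. Qed.

Section Diagram.
Variable D : diagram.

Lemma curve_periodic_Z i t k : curve D i (t + IZR k) = curve D i t.
Proof.
assert (N : forall n t, curve D i (t + INR n) = curve D i t).
{ intros n; induction n as [|n IH]; intros u; [now rewrite Rplus_0_r|].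
  rewrite S_INR, <- Rplus_assoc, curve_periodic; apply IH. }
destruct (Z_le_gt_dec 0 k) as [Hk|Hk].
- rewrite <- (Z2Nat.id k), <- INR_IZR_INZ by easy; apply N.
- rewrite <- (N (Z.to_nat (- k)) (t + IZR k)); f_equal.
  rewrite INR_IZR_INZ, Z2Nat.id, opp_IZR by lia; ring.
Qed.

Lemma circle_representative i s :
  exists r k, 0 <= r < 1 /\ s = r + IZR k /\ curve D i r = curve D i s.
Proof.
destruct (floor_ex s) as [k Hk].
exists (s - IZR k), k; repeat split; try lra.
rewrite <- (curve_periodic_Z i (s - IZR k) k); f_equal; ring.
Qed.

(** A non-self crossing, as the pair of its parameters on [i] and on the other
    component. *)
Definition meets (i : component) (p : R * R) : Prop :=
  crossing (curve D) (i, fst p) (other i, snd p).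

Lemma at_nonself_crossing_meets i t :
  at_nonself_crossing D i t <-> exists s, meets i (t, s).
Proof.
split.
- intros ([j s] & Hc & Hj); exists s; unfold meets; cbn in *.
  replace (other i) with j; [easy|destruct i, j; easy].
- intros (s & Hm); exists (other i, s); split; [easy|]; destruct i; easy.
Qed.

Lemma meets_swap i p : meets i p <-> meets (other i) (snd p, fst p).
Proof. unfold meets; cbn; destruct i; cbn; split; apply crossing_sym. Qed.

(** Its sign is the sign of the crossing: the side from which component [i] crosses
    the other one. *)
Definition crossing_det (i : component) (p : R * R) : R :=
  triple (curve D i (fst p)) (velocity (curve D i) (fst p))
         (velocity (curve D (other i)) (snd p)).

(** The sign changes because the two velocities are exchanged. *)
Lemma crossing_det_swap i p :
  meets i p -> crossing_det (other i) (snd p, fst p) = - crossing_det i p.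
Proof.
intros (_ & _ & _ & E); unfold crossing_det; cbn in *.
replace (other (other i)) with i by now destruct i.
rewrite E; unfold triple, dot3, cross; cbn; ring.
Qed.

Lemma crossing_det_neq_0 i p : meets i p -> crossing_det i p <> 0.
Proof.
intros H; assert (T := crossings_transverse D _ _ H); destruct H as (_ & _ & _ & E).
unfold crossing_det; cbn in *; intros Z; apply T.
rewrite (cross_parallel (curve D i (fst p))).
- rewrite Z; f_equal; ring.
- apply curve_on_S2.
- apply velocity_tangent; [apply curve_smooth|apply curve_on_S2].
- rewrite E; apply velocity_tangent; [apply curve_smooth|apply curve_on_S2].
Qed.

Definition crossing_sign (i : component) (p : R * R) : R := sign (crossing_det i p).

Lemma pairing_exists i ts :
  (forall t, In t ts -> at_nonself_crossing D i t) ->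
  exists ps, map fst ps = ts /\ forall p, In p ps -> meets i p.
Proof.
induction ts as [|t ts IH]; intros H.
- exists nil; split; [easy|intros p []].
- destruct IH as (ps & E & Hp); [intros; apply H; now right|].
  destruct (proj1 (at_nonself_crossing_meets i t) (H t (or_introl eq_refl))) as [s Hs].
  exists ((t, s) :: ps); split; [cbn; now f_equal|].
  intros p [<-|Hi]; auto.
Qed.

Lemma pairing_complete i ts ps :
  (forall t, In t ts <-> at_nonself_crossing D i t) ->
  map fst ps = ts -> (forall p, In p ps -> meets i p) ->
  forall p, In p ps <-> meets i p.
Proof.
intros Hts E Hp [t s]; split; [apply Hp|]; intros Hm.
assert (Hin : In t ts) by (apply Hts, at_nonself_crossing_meets; now exists s).
rewrite <- E in Hin; apply in_map_iff in Hin as ([t' s'] & E1 & Hin); cbn in E1; subst t'.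
assert (X := crossings_double D _ _ _ Hm (Hp _ Hin)); cbn in X.
injection X as ->; easy.
Qed.

Hypothesis Hself : ~ has_self_crossing D.

Lemma curve_injective i r r' :
  0 <= r < 1 -> 0 <= r' < 1 -> curve D i r = curve D i r' -> r = r'.
Proof.
intros Hr Hr' E; destruct (Req_dec r r') as [|Hn]; [easy|].
elim Hself; exists (i, r), (i, r'); split; [|easy].
repeat split; cbn; try lra; [congruence|easy].
Qed.

Lemma curve_simple i s t : 0 < t < 1 -> curve D i (s + t) <> curve D i s.
Proof.
intros Ht E.
destruct (circle_representative i s) as (r & k & Hr & Er & Cr).
destruct (circle_representative i (s + t)) as (r' & k' & Hr' & Er' & Cr').
assert (r = r') by (apply (curve_injective i); congruence).
assert (T : t = IZR (k' - k)) by (rewrite minus_IZR; lra).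
rewrite T in Ht; destruct Ht as [H0 H1]; apply lt_IZR in H0, H1; lia.
Qed.

(** The pole for the stereographic projection is taken on component [i] itself, just
    after the arc: by simplicity it lies off the arc, and for all but finitely many
    choices it lies off the other component. *)
Lemma crossing_det_alternates i p q :
  meets i p -> meets i q -> fst p < fst q ->
  (forall t, fst p < t < fst q -> ~ at_nonself_crossing D i t) ->
  crossing_det i p * crossing_det i q < 0.
Proof.
intros Hp Hq Hlt Hgap.
assert (Tp := crossing_det_neq_0 i p Hp); assert (Tq := crossing_det_neq_0 i q Hq).
destruct Hp as (P1 & P2 & _ & P4), Hq as (Q1 & Q2 & _ & Q4).
unfold circle_point in *; cbn in *.
destruct (crossings_finite D) as [l Hl].
destruct (avoid_finite (map snd l) (fst q) 1) as (tau & Htau & Hfree); [lra|].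
assert (Meet : forall t s, 0 <= t < 1 -> curve D (other i) s = curve D i t ->
  exists r, meets i (t, r)).
{ intros t s Ht E; destruct (circle_representative (other i) s) as (r & k & Hr & Er & Cr).
  exists r; unfold meets; repeat split; cbn; try lra; [|congruence].
  destruct i; easy. }
apply (crossing_sign_alternates (curve D i) (curve D (other i)) (curve D i tau)
  (fst p) (fst q) (snd p) (snd q)); auto; try apply curve_smooth; try apply curve_on_S2.
- apply curve_periodic.
- apply curve_regular.
- apply curve_simple.
- intros s E; destruct (Meet tau s) as [r Hr]; [lra|easy|].
  apply Hfree, in_map_iff; exists (i, tau); split; [easy|exact (Hl _ _ Hr)].
- intros t Ht E; apply curve_injective in E; lra.
- lra.
- lra.
- intros t s Ht E; apply (Hgap t Ht), at_nonself_crossing_meets, (Meet t s); [lra|easy].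
Qed.

Lemma pairing_alternates i ts ps :
  StronglySorted Rlt ts -> (forall t, In t ts <-> at_nonself_crossing D i t) ->
  map fst ps = ts -> (forall p, In p ps -> meets i p) ->
  Sorted (fun p q => crossing_sign i q = - crossing_sign i p) ps.
Proof.
intros HS Hts E Hp.
assert (Main : forall post pre, pre ++ post = ps ->
  Sorted (fun p q => crossing_sign i q = - crossing_sign i p) post).
{ induction post as [|p post IH]; intros pre Epre; [constructor|].
  constructor; [apply (IH (pre ++ p :: nil)); now rewrite <- app_assoc|].
  destruct post as [|q post]; constructor.
  rewrite <- Epre, map_app in E; cbn [map] in E; rewrite <- E in HS.
  destruct (strongly_sorted_gap _ _ _ _ HS) as [Hlt Hgap]; rewrite E in Hgap.
  assert (X : crossing_det i p * crossing_det i q < 0).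
  { apply crossing_det_alternates; auto.
    - apply Hp; rewrite <- Epre; apply in_or_app; right; now left.
    - apply Hp; rewrite <- Epre; apply in_or_app; right; right; now left.
    - intros t Ht Ha; apply (Hgap t); [now apply Hts|easy]. }
  unfold crossing_sign.
  destruct (Rtotal_order (crossing_det i p) 0) as [H|[H|H]]; [|nra|].
  - rewrite (sign_eq_m1 _ H), sign_eq_1; [ring|nra].
  - rewrite (sign_eq_1 _ H), sign_eq_m1; [ring|nra]. }
exact (Main ps nil eq_refl).
Qed.

(** The right-hand side refers to the crossings as a set, and no longer to the order
    in which component [i] meets them. *)
Lemma OU_number_eq_sum i w :
  Nat.Even (length w) -> is_nonself_OU D i w ->
  exists ps, NoDup ps /\ (forall p, In p ps <-> meets i p) /\
  OU_number w =
    / 2 * Rabs (sum_over (fun p => letter_sign (pass D i (fst p)) * crossing_sign i p) ps).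
Proof.
intros Hev (ts & HS & Hts & Hrot).
destruct (pairing_exists i ts) as (ps & E & Hp); [intros; now apply Hts|].
exists ps; split; [|split].
- apply (NoDup_map_inv fst); rewrite E; clear - HS.
  induction HS as [|t ts HS IH F]; constructor; auto.
  rewrite Forall_forall in F; intros Hi; specialize (F t Hi); lra.
- now apply (pairing_complete i ts).
- assert (Hlen : length (map (pass D i) ts) = length w).
  { destruct Hrot as (u & v & -> & ->); rewrite !length_app; lia. }
  rewrite <- (OU_number_rotation _ _ ltac:(now rewrite Hlen) Hrot).
  unfold OU_number; rewrite <- E, map_map.
  apply (Phi_seq_alternating (fun p => pass D i (fst p))).
  + intros p Hi; specialize (crossing_det_neq_0 i p (Hp p Hi)); intros H.
    unfold crossing_sign; destruct (Rtotal_order (crossing_det i p) 0) as [G|[G|G]]; [|easy|].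
    * rewrite sign_eq_m1 by easy; ring.
    * rewrite sign_eq_1 by easy; ring.
  + now apply (pairing_alternates i ts).
Qed.

(** Exchanging the components changes both the letter and the sign of a crossing. *)
Lemma contribution_swap i p :
  meets i p ->
  letter_sign (pass D (other i) (snd p)) * crossing_sign (other i) (snd p, fst p) =
  letter_sign (pass D i (fst p)) * crossing_sign i p.
Proof.
intros H; unfold crossing_sign; rewrite (crossing_det_swap i p H), sign_opp.
assert (N := crossings_over_under D _ _ H); cbn in N.
destruct (pass D i (fst p)), (pass D (other i) (snd p)); try easy; cbn; ring.
Qed.

End Diagram.

Theorem proposition1 (w1 w2 : list letter)
  (even1 : Nat.Even (length w1)) (even2 : Nat.Even (length w2))
  (hPhi : OU_number w1 <> OU_number w2)
  (D : diagram) (hD : is_nonself_OU_pair D (w1, w2)) :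
  has_self_crossing D.
Proof.
apply NNPP; intros Hself; apply hPhi; destruct hD as [h1 h2].
destruct (OU_number_eq_sum D Hself K1 w1 even1 h1) as (ps & ND1 & M1 & ->).
destruct (OU_number_eq_sum D Hself K2 w2 even2 h2) as (qs & ND2 & M2 & ->).
assert (P : Permutation (map (fun p => (snd p, fst p)) ps) qs).
{ apply NoDup_Permutation; auto.
  - apply FinFun.Injective_map_NoDup; [|easy].
    intros [t s] [t' s'] [= -> ->]; easy.
  - intros [s t]; rewrite M2, in_map_iff; split.
    + intros ([t' s'] & [= <- <-] & Hi); apply M1 in Hi; now apply (meets_swap D K1) in Hi.
    + intros Hm; exists (t, s); split; [easy|]; apply M1, (meets_swap D K1), Hm. }
rewrite <- (sum_over_permutation _ _ _ P).
do 2 f_equal; unfold sum_over; rewrite map_map; f_equal.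
apply map_ext_in; intros p Hi; symmetry; apply (contribution_swap D K1), M1, Hi.
Qed.
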